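(* Let $g_1,\dots,g_p$ be holomorphic functions on a domain $\Omega\subset\mathbb C^n$, let $|g|^2=\sum_{j=1}^p|g_j|^2$, and let $\Omega^*$ be the complement in $\Omega$ of the common zero-set of $g_1,\dots,g_p$. Let $\mathcal K\subset(\mathcal O_{\Omega^*})^{\oplus p}$ be the kernel subbundle over $\Omega^*$ of the bundle-homomorphism $(g_1,\dots,g_p):(\mathcal O_{\Omega^*})^{\oplus p}\to\mathcal O_{\Omega^*}$, let $H=(H_{j\bar k})$ be the metric on $\mathcal K$ induced from the standard flat metric of $(\mathcal O_{\Omega^*})^{\oplus p}$, and for $\gamma>0$ let $$H(\gamma):=\frac{H_{j\bar k}}{|g|^{2\gamma}},$$ with curvature $\Theta(\gamma)_{j\bar k\lambda\bar\nu}$. If $\gamma\ge\min(n,p-1)$, then the Hermitian form $$ (v^{j\lambda})_{1\le j\le p,\,1\le\lambda\le n}\mapsto\sum_{1\le j,k\le p,\,1\le\lambda,\nu\le n}\Theta(\gamma)_{j\bar k\lambda\bar\nu}\,v^{j\lambda}\overline{v^{k\nu}} $$ on $\mathcal K\otimes T_{\Omega^*}$ defined by the curvature of $H(\gamma)$ dominates $\gamma-\min(n,p-1)$ times the Hermitian form $$ (v^{j\lambda})_{1\le j\le p,\,1\le\lambda\le n}\mapsto\sum_{1\le\lambda,\nu\le n}\left(\partial_\lambda\partial_{\bar\nu}\log|g|^2\right)\left(\sum_{j=1}^p v^{j\lambda}\overline{v^{j\nu}}\right) $$ defined by (the tensor product of the identity operator of $\mathcal K$ and) $\partial\bar\partial\log|g|^2$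 on $\mathcal K\otimes T_{\Omega^*}$. Here $v=(v^{j\lambda})$ ranges over the elements of $\mathcal K\otimes T_{\Omega^*}$, i.e. $\sum_{j=1}^p g_jv^{j\lambda}=0$ for $1\le\lambda\le n$.
   Context: Notation: $\partial_\lambda=\partial/\partial z^\lambda$, $\partial_{\bar\nu}=\partial/\partial\overline{z^\nu}$ for the coordinates $z^1,\dots,z^n$ of $\mathbb C^n$; $T$ is the holomorphic tangent bundle. $(\mathcal O)^{\oplus p}$ denotes the trivial holomorphic vector bundle of rank $p$, and the homomorphism $(g_1,\dots,g_p)$ sends $(w_1,\dots,w_p)$ to $\sum_j g_jw_j$. An element of $\mathcal K\otimes T$ at a point is written, via $\mathcal K\subset\mathcal O^{\oplus p}$, as $(v^{j\lambda})_{1\le j\le p,1\le\lambda\le n}$ with $\sum_j g_jv^{j\lambda}=0$ for all $\lambda$; the expression with $\Theta(\gamma)_{j\bar k\lambda\bar\nu}$ denotes the value at this element of the Hermitian form on $\mathcal K\otimes T$ defined by the curvature. Curvature: for a holomorphic vector bundle $W$ with smooth Hermitian metric $h$ and local holomorphic frame $(e_a)$, $h_{a\bar b}=\langle e_a,e_b\rangle_h$ with inverse $h^{\bar b a}$, put $$\Theta_{a\bar b\lambda\bar\nu}=-\partial_\lambda\partial_{\bar\nu}h_{a\bar b}+\sum_{c,d}h^{\bar d c}(\partial_\lambda h_{a\bar d})(\partial_{\bar\nu}h_{c\bar b}).$$ The Hermitian form on $W\otimes T$ it defines (the Nakano curvature) is $\sum_{a,\lambda}w^{a\lambda}e_a\otimes\partial_\lambda\mapsto\sum_{a,b,\lambda,\nu}\Theta_{a\bar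 b\lambda\bar\nu}w^{a\lambda}\overline{w^{b\nu}}$. With this sign, a line bundle metric $e^{-\varphi}$ has nonnegative curvature exactly when $\varphi$ is plurisubharmonic. A Hermitian form $A$ dominates $B$ if $B\le A$, i.e. $A-B$ is positive semidefinite.
   Formalization: The second Hermitian form is taken with the metric H(γ), i.e. the displayed form is multiplied by |g|^{-2γ}; without this factor the displayed inequality fails, e.g. n=1, p=2, g=(10,z), γ=2, z=0, v=(0,1). *)

(* Defs.v *)
From HB Require Import structures.
From mathcomp Require Import all_boot all_order all_algebra.
From mathcomp Require Import complex.
From mathcomp Require Import all_classical all_reals all_analysis.

Set Implicit Arguments.
Unset Strict Implicit.
Unset Printing Implicit Defensive.

Import Order.TTheory GRing.Theory Num.Theory.
Import numFieldNormedType.Exports.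

Local Open Scope classical_set_scope.
Local Open Scope complex_scope.
Local Open Scope ring_scope.

(* The complex numbers. MathComp-Analysis puts a topology and a norm on (the sort of)
   any [numClosedFieldType], but R[i] alone is not recognized as one. *)
Definition Cplx (R : realType) : numClosedFieldType := R[i].

Section SeveralComplexVariables.
Variables (R : realType) (n : nat).
Local Notation C := (Cplx R).
Local Notation Cn := 'rV[Cplx R]_n.

Definition is_domain (Omega : set Cn) : Prop :=
  [/\ open Omega, connected Omega & Omega !=set0].

(* Both sides are normed spaces over C, so [differentiable] is Frechet
   differentiability with a C-linear differential. *)
Definition holomorphic_on (U : set Cn) (f : Cn -> C) : Prop :=
  forall z, U z -> differentiable f z.

(* The derivative at t = 0 of the curve t |-> F (z + t u), t real. *)
Definition real_dir_derive (F : Cn -> C) (u z : Cn) : C :=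
  Complex (derive1 (fun t : R => complex.Re (F (z + t%:C *: u))) 0)
          (derive1 (fun t : R => complex.Im (F (z + t%:C *: u))) 0).

(* Wirtinger derivatives: with z^l = x^l + i y^l,
   d/dz^l = (d/dx^l - i d/dy^l) / 2 and d/d(conj z^l) = (d/dx^l + i d/dy^l) / 2. *)
Definition dz (l : 'I_n) (F : Cn -> C) (z : Cn) : C :=
  (real_dir_derive F (delta_mx 0 l) z
   - 'i * real_dir_derive F ('i *: delta_mx 0 l) z) / 2.

Definition dzbar (l : 'I_n) (F : Cn -> C) (z : Cn) : C :=
  (real_dir_derive F (delta_mx 0 l) z
   + 'i * real_dir_derive F ('i *: delta_mx 0 l) z) / 2.

(* Theta_{a bbar l mubar} for the Gram matrix h = (h_{a bbar}) of a metric in a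
   local holomorphic frame; the entry h^{dbar c} is [invmx (h z) d c]. *)
Definition curvature (r : nat) (h : Cn -> 'M[C]_r) (z : Cn)
    (a b : 'I_r) (l m : 'I_n) : C :=
  - dz l (dzbar m (fun x => h x a b)) z
  + \sum_c \sum_d invmx (h z) d c * dz l (fun x => h x a d) z
                                  * dzbar m (fun x => h x c b) z.

Definition nakano_sum (r : nat) (h : Cn -> 'M[C]_r) (z : Cn) (w : 'M[C]_(r, n)) : C :=
  \sum_a \sum_b \sum_l \sum_m curvature h z a b l m * w a l * (w b m)^*.

Section Subbundle.
Variable p : nat.

(* A subbundle of the trivial bundle of rank p is given by the family of its fibres,
   the fibre at z being the row space of [W z]. *)
Implicit Types (W : Cn -> 'M[C]_p) (k : Cn -> 'rV[C]_p -> 'rV[C]_p -> C).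

Definition local_holomorphic_frame (X : set Cn) W (r : nat) (U : set Cn)
    (E : Cn -> 'M[C]_(r, p)) : Prop :=
  [/\ open U, U `<=` X,
      forall a j, holomorphic_on U (fun z => E z a j) &
      forall z, U z -> row_free (E z) /\ (E z :=: W z)%MS].

Definition gram k (r : nat) (E : Cn -> 'M[C]_(r, p)) (z : Cn) : 'M[C]_r :=
  \matrix_(a, b) k z (row a (E z)) (row b (E z)).

(* An element of W (x) T at z, W being a subbundle over X of the trivial bundle, is
   written as the matrix v of its components v^{j l}; [nakano_value X W k z v c] says
   that c is the value at v of the Hermitian form on W (x) T defined by the curvature
   of the metric k, computed in some local holomorphic frame (e_a) of W around z,
   with v^{j l} = sum_a w^{a l} e_a^j. *)
Definition nakano_value (X : set Cn) W k (z : Cn) (v : 'M[C]_(p, n)) (c : C) : Prop :=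
  exists (r : nat) (U : set Cn) (E : Cn -> 'M[C]_(r, p)) (w : 'M[C]_(r, n)),
    [/\ U z, local_holomorphic_frame X W U E, v = (E z)^T *m w &
        c = nakano_sum (gram k E) z w].

(* The Hermitian form on W (x) T defined by the tensor product of the identity of W
   (turned into a Hermitian form by the metric k) and of the form
   sum_(l, m) (dz l (dzbar m phi)) dz^l (x) d(conj z^m).
   To compare it with the curvature form of k, whose index a bbar is lowered with k,
   one has to use the same k here: multiplying k by a constant multiplies
   [nakano_value] by that constant. *)
Definition id_tensor_levi k (phi : Cn -> R) (z : Cn) (v : 'M[C]_(p, n)) : C :=
  \sum_l \sum_m dz l (dzbar m (fun x => (phi x)%:C)) z
                * k z (row l v^T) (row m v^T).

Variable g : 'I_p -> Cn -> C.

Definition normsq (z : Cn) : R :=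
  \sum_j (complex.Re (g j z) ^+ 2 + complex.Im (g j z) ^+ 2).

Definition off_zeros (Omega : set Cn) : set Cn :=
  Omega `&` [set z | exists j, g j z != 0].

(* The row space of [kermx A] is the set of x such that x *m A = 0. *)
Definition kernel_bundle (z : Cn) : 'M[C]_p :=
  kermx (\col_j g j z : 'M[C]_(p, 1)).

Definition in_kernel_tensor_T (z : Cn) (v : 'M[C]_(p, n)) : Prop :=
  forall l, \sum_j g j z * v j l = 0.

Definition flat_metric (_ : Cn) (x y : 'rV[C]_p) : C :=
  \sum_j x 0 j * (y 0 j)^*.

(* Extends H(gamma) from the kernel bundle to the trivial bundle of rank p. *)
Definition twisted_metric (gamma : R) (z : Cn) (x y : 'rV[C]_p) : C :=
  flat_metric z x y / (normsq z `^ gamma)%:C.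

End Subbundle.
End SeveralComplexVariables.

(* Main.v *)
Require Import Defs.
From HB Require Import structures.
From mathcomp Require Import all_boot all_order all_algebra.
From mathcomp Require Import complex.
From mathcomp Require Import all_classical all_reals all_analysis.
From mathcomp Require Import ring lra.

Set Implicit Arguments.
Unset Strict Implicit.
Unset Printing Implicit Defensive.

Import Order.TTheory GRing.Theory Num.Theory.
Import numFieldNormedType.Exports.

Local Open Scope classical_set_scope.
Local Open Scope complex_scope.
Local Open Scope ring_scope.

(** Put [N = |g|^2] and [m = min(n, p-1)]. Let [v] be an element of the kernel tensored with
    the tangent space, and let [L] be the value at [v] of the identity of the kernel
    tensored with the complex Hessian of [log N]. The flat bundle has no curvature, so the
    curvature of the kernel is minus the square of its second fundamental form, and the
    weight [N^-gamma] adds [gamma] times the Hessian of [log N]. In a frame whose rows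
    satisfy [E *m g = 0], the derivatives of the frame can be traded for those of [g], and
    the curvature form at [v] becomes
      [N^-gamma * (gamma * L - |sum_(l,j) v_jl * d_l g_j|^2 / N)]
    (lemma [nakano_sum_gram]). The theorem thus says that the subtracted term is at most
    [m * L].

    This is linear algebra (lemma [trace_levi_bound]). Let [G] be the matrix whose rows are
    the components of the [d_l g] orthogonal to [g]. Since [v] is annihilated by [g], the sum
    above is the trace of [v *m G], while [N * L] is the squared Hilbert-Schmidt norm of
    [v *m G]. The squared modulus of a trace is at most the rank times the squared
    Hilbert-Schmidt norm (lemma [trace_rank_bound]), and [v *m G] has rank at most [n],
    and at most [p-1] because the columns of [v] lie in a hyperplane.

    The curvature involves second derivatives of functions that are only supposed to be
    complex differentiable at each point of an open set. That their partial derivatives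
    can be differentiated again (lemma [derivable_derive]) is proved from Goursat's theorem
    for rectangles: it yields a Cauchy formula for the first derivative over squares, hence
    Cauchy estimates, hence Lipschitz bounds for directional derivatives and quadratic
    remainders that are uniform enough to differentiate the Cauchy formula once more.

    Finally, near a point where [g j0] does not vanish, the relations between [g j0] and the
    other [g j] form a holomorphic frame of the kernel (lemma [syzygy_frame_kernel]), so
    the curvature form has a value at [v]. *)

(** * Moduli and limits in the complex plane *)

Section ComplexPlane.
Variable R : realType.
Local Notation C := (Cplx R).
Local Notation Re := complex.Re.
Local Notation Im := complex.Im.
Local Notation modc := (@ComplexField.Normc.normc R).

Lemma normcE (z : C) : `|z| = (modc z)%:C. Proof. by []. Qed.

Lemma modc_ge0 (z : C) : 0 <= modc z.
Proof. by rewrite -lecR -normcE normr_ge0. Qed.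

Lemma modcM (y z : C) : modc (y * z) = modc y * modc z.
Proof. exact: ComplexField.Normc.normcM. Qed.

Lemma modcD (y z : C) : modc (y + z) <= modc y + modc z.
Proof. by rewrite -lecR rmorphD /= -!normcE ler_normD. Qed.

Lemma modcB (y z : C) : modc (y - z) <= modc y + modc z.
Proof. by rewrite -lecR rmorphD /= -!normcE ler_normB. Qed.

Lemma modcV (z : C) : modc z^-1 = (modc z)^-1.
Proof. exact: ComplexField.Normc.normcV. Qed.

Lemma modcN (z : C) : modc (- z) = modc z.
Proof. by apply: complexI; rewrite -!normcE normrN. Qed.

Lemma modc_real (x : R) : modc (x%:C : C) = `|x|.
Proof. by rewrite /= expr0n addr0 sqrtr_sqr. Qed.

Lemma modc_i : modc ('i : C) = 1.
Proof. by rewrite /= expr0n /= expr1n add0r sqrtr1. Qed.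

Lemma modc_gt0 (z : C) : z != 0 -> 0 < modc z.
Proof. by move=> z0; rewrite -ltcR -normcE normr_gt0. Qed.

Lemma modc_eq0 (z : C) : modc z = 0 -> z = 0.
Proof. exact: ComplexField.Normc.eq0_normc. Qed.

Lemma modc_small (z : C) : (forall e, 0 < e -> modc z <= e) -> z = 0.
Proof.
move=> ze; apply: modc_eq0; apply/eqP; rewrite eq_le modc_ge0 andbT.
by apply/ler_addgt0Pr => e e0; rewrite add0r ze.
Qed.

Lemma Re_le_modc (z : C) : `|Re z| <= modc z.
Proof. by rewrite -lecR; exact: normc_ge_Re. Qed.

Lemma Im_le_modc (z : C) : `|Im z| <= modc z.
Proof.
case: z => x y /=; rewrite -sqrtr_sqr ler_wsqrtr// lerDr sqr_ge0 //.
Qed.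

Lemma modc_le_ReIm (z : C) : modc z <= `|Re z| + `|Im z|.
Proof.
case: z => x y.
have -> : (x +i* y : C) = x%:C + 'i * y%:C :> C by simpc.
apply: le_trans (modcD _ _) _.
by rewrite modcM modc_i mul1r !modc_real /= !mul0r !mul1r !oppr0 !addr0 !add0r.
Qed.

(** Positive complex numbers are the positive reals, so neighbourhoods in C can
    be described by real radii. *)
Lemma near_modcP (z : C) (P : set C) :
  (\forall w \near z, P w) <->
  exists2 e : R, 0 < e & forall w, modc (w - z) < e -> P w.
Proof.
split.
  move=> /nbhs_ballP [[e1 e2] /= e0 zP].
  move: e0; rewrite ltcE /= => /andP[/eqP e20 e10]; rewrite e20 in zP.
  exists e1 => // w wz; apply: zP; rewrite /ball /= distrC normcE.
  by rewrite -[e1 +i* 0]/(e1%:C) ltcR.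
move=> [e e0 zP]; apply/nbhs_ballP; exists e%:C; first by rewrite /= ltcR.
by move=> w; rewrite /ball /= distrC normcE ltcR; exact: zP.
Qed.

Lemma cvg_modcP (T : Type) (F : set_system T) (FF : Filter F) (f : T -> C) (l : C) :
  f @ F --> l <-> forall e : R, 0 < e -> \forall t \near F, modc (f t - l) < e.
Proof.
split.
  move=> /cvgrPdist_lt fl e e0.
  have /fl : 0 < e%:C by rewrite ltcR.
  by apply: filterS => t; rewrite distrC normcE ltcR.
move=> fl; apply/cvgrPdist_lt => -[e1 e2]; rewrite ltcE /= => /andP[/eqP -> /fl].
by apply: filterS => t; rewrite distrC normcE => ?; rewrite -[e1 +i* 0]/(e1%:C) ltcR.
Qed.

Lemma cvg_ReIm (T : Type) (F : set_system T) (FF : Filter F) (f : T -> C) (l : C) :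
  f @ F --> l <->
  ((fun t => Re (f t)) @ F --> Re l /\ (fun t => Im (f t)) @ F --> Im l).
Proof.
split.
  move=> /cvg_modcP fl; split; apply/cvgrPdist_lt => e /fl; apply: filterS => t;
    apply: le_lt_trans; rewrite distrC -raddfB; [exact: Re_le_modc | exact: Im_le_modc].
move=> [/cvgrPdist_lt fr /cvgrPdist_lt fi]; apply/cvg_modcP => e e0.
have e20 : 0 < e / 2 by rewrite divr_gt0.
near=> t.
apply: le_lt_trans (modc_le_ReIm _) _; rewrite !raddfB /= [ltRHS]splitr ltrD //.
  by rewrite distrC; near: t; exact: fr.
by rewrite distrC; near: t; exact: fi.
Unshelve. all: by end_near. Qed.

Lemma continuous_real_complex : continuous (fun t : R => t%:C : C).
Proof.
by move=> t; apply/cvg_ReIm; split => /=; [exact: cvg_id | exact: cvg_cst].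
Qed.

End ComplexPlane.

(** * Complex integrals over segments *)

Section ComplexIntegral.
Variable R : realType.
Local Notation C := (Cplx R).
Local Notation Re := complex.Re.
Local Notation Im := complex.Im.
Local Notation modc := (@ComplexField.Normc.normc R).
Local Notation mu := (@lebesgue_measure R).

Definition continuous_on_segment (f : R -> C) (a b : R) : Prop :=
  forall t, a <= t <= b -> {for t, continuous f}.

Definition cint (f : R -> C) (a b : R) : C :=
  (\int[mu]_(t in `[a, b]) Re (f t)) +i* (\int[mu]_(t in `[a, b]) Im (f t)).

Lemma continuous_on_segmentB f g a b : continuous_on_segment f a b ->
  continuous_on_segment g a b -> continuous_on_segment (fun t => f t - g t) a b.
Proof. by move=> fc gc t tab; apply: continuousB; [exact: fc | exact: gc]. Qed.

Lemma integrable_ReIm f a b : continuous_on_segment f a b ->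
  mu.-integrable `[a, b] (EFin \o (fun t => Re (f t))) /\
  mu.-integrable `[a, b] (EFin \o (fun t => Im (f t))).
Proof.
move=> fc; split; apply: continuous_compact_integrable;
  try exact: segment_compact;
  apply: continuous_in_subspaceT => t; rewrite inE /= in_itv /= => /fc /cvg_ReIm;
  by case.
Qed.

Lemma eq_cint f g a b : (forall t, a <= t <= b -> f t = g t) -> cint f a b = cint g a b.
Proof.
move=> fg; rewrite /cint.
by congr Complex; apply: eq_Rintegral => t;
  rewrite inE /= in_itv /= => /fg ->.
Qed.

Lemma cintD f g a b : continuous_on_segment f a b -> continuous_on_segment g a b ->
  cint (fun t => f t + g t) a b = cint f a b + cint g a b.
Proof.
move=> /integrable_ReIm[fr fi] /integrable_ReIm[gr gi].
by rewrite /cint; congr Complex; rewrite -RintegralD //; apply: eq_Rintegral => t _;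
  rewrite raddfD.
Qed.

Lemma cintZ (k : C) f a b : continuous_on_segment f a b ->
  cint (fun t => k * f t) a b = k * cint f a b.
Proof.
case: k => x y /integrable_ReIm[fr fi]; rewrite /cint.
have mi (g : R -> R) w : mu.-integrable `[a, b] (EFin \o g) ->
    mu.-integrable `[a, b] (EFin \o (fun t => w * g t)).
  move=> gi; rewrite (_ : EFin \o _ = fun t => w%:E * (EFin \o g) t)%E.
    exact: integrableZl.
  by apply/funext => t; rewrite /= EFinM.
apply/eqP; rewrite eq_complex /=; apply/andP; split; apply/eqP.
  rewrite -!RintegralZl // -RintegralB //; [|exact: mi..].
  by apply: eq_Rintegral => t _; case: (f t).
rewrite -!RintegralZl // -RintegralD //; [|exact: mi..].
by apply: eq_Rintegral => t _; case: (f t).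
Qed.

Lemma Rintegral_segment_cst (k a b : R) : a <= b ->
  \int[mu]_(t in `[a, b]) k = k * (b - a).
Proof.
move=> ab; rewrite Rintegral_cst //; congr (_ * _).
rewrite [X in fine X](_ : _ = (b - a)%:E) //.
apply: etrans (lebesgue_measure_itv _) _; rewrite /= lte_fin.
by case: ltP => // ba; rewrite (@le_anti _ _ a b) ?subrr ?ab.
Qed.

Lemma cint_cst (k : C) a b : a <= b -> cint (fun=> k) a b = k * (b - a)%:C.
Proof.
move=> ab; case: k => x y; rewrite /cint !Rintegral_segment_cst //.
by simpc.
Qed.

Lemma cint_cat f a m b : a <= m -> m <= b -> continuous_on_segment f a b ->
  cint f a b = cint f a m + cint f m b.
Proof.
move=> am mb /integrable_ReIm[fr fi].
have split_at (g : R -> R) : mu.-integrable `[a, b] (EFin \o g) ->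
    \int[mu]_(t in `[a, b]) g t =
    \int[mu]_(t in `[a, m]) g t + \int[mu]_(t in `[m, b]) g t.
  move=> gi.
  rewrite -(@Rintegral_itv_obnd_cbnd _ m (BRight b)); last first.
    apply: integrableS gi => //; apply: subset_itv; rewrite ?bnd_simp //.
  by rewrite -(Rintegral_itvB gi) ?bnd_simp // addrC subrK.
by rewrite /cint (split_at _ fr) (split_at _ fi).
Qed.

(** The real and imaginary parts are estimated separately, whence the factor 2. *)
Lemma cint_bound f a b (M : R) : a <= b -> continuous_on_segment f a b ->
  (forall t, a <= t <= b -> modc (f t) <= M) ->
  modc (cint f a b) <= 2 * (M * (b - a)).
Proof.
move=> ab /integrable_ReIm[fr fi] fM.
have bnd (g : R -> R) : mu.-integrable `[a, b] (EFin \o g) ->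
    (forall t, a <= t <= b -> `|g t| <= M) ->
    `|\int[mu]_(t in `[a, b]) g t| <= M * (b - a).
  move=> gi gM; apply: le_trans (le_normr_Rintegral _ gi) _ => //.
  rewrite -(Rintegral_segment_cst M ab).
  apply: le_Rintegral => //; first exact: integrable_norm.
    apply: continuous_compact_integrable; first exact: segment_compact.
    by apply: continuous_subspaceT => x; exact: cvg_cst.
apply: le_trans (modc_le_ReIm _) _; rewrite mulr_natl mulr2n.
apply: lerD; apply: bnd => // t tab.
  by apply: le_trans (Re_le_modc _) (fM _ tab).
by apply: le_trans (Im_le_modc _) (fM _ tab).
Qed.

End ComplexIntegral.

(** * Integrals over the boundary of a rectangle *)

Section RectangleIntegral.
Variable R : realType.
Local Notation C := (Cplx R).
Local Notation Re := complex.Re.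
Local Notation Im := complex.Im.
Local Notation modc := (@ComplexField.Normc.normc R).

Lemma is_derive_modcP (V : normedModType C) (f : V -> C) (z v : V) (D : C) :
  is_derive z v f D <-> forall eta : R, 0 < eta -> exists2 delta : R, 0 < delta &
    forall h : C, modc h < delta -> modc (f (z + h *: v) - f z - h * D) <= eta * modc h.
Proof.
pose q (h : C) := h^-1 *: ((f \o shift z) (h *: v) - f z).
have qE (h : C) : h != 0 ->
    modc (f (z + h *: v) - f z - h * D) = modc h * modc (q h - D).
  by move=> h0; rewrite -modcM mulrBr /q /GRing.scale /= mulVKf // (addrC z).
have -> : is_derive z v f D <-> q @ 0^' --> D.
  split; first by case=> fd <-; exact: fd.
  move=> qD; apply: DeriveDef; first by apply/cvg_ex; exists D.
  exact: (cvg_lim (@norm_hausdorff _ _) qD).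
rewrite cvg_modcP; split.
  move=> qD eta /qD /near_modcP[delta d0 near_q]; exists delta => // h hd.
  have [->|h0] := eqVneq h 0.
    by rewrite scale0r addr0 subrr mul0r subr0 -[modc _]/(modc 0) ComplexField.Normc.normc0 mulr0.
  rewrite qE // mulrC ler_wpM2r ?modc_ge0 // ltW //.
  by apply: near_q; rewrite ?subr0.
move=> fD eta eta0.
have [|delta d0 near_f] := fD (eta / 2); first by rewrite divr_gt0.
apply/near_modcP; exists delta => // h; rewrite subr0 => hd h0.
have := near_f _ hd; rewrite qE // mulrC ler_pM2r ?modc_gt0 // => /le_lt_trans; apply.
by rewrite ltr_pdivrMr // ltr_pMr // ltr1n.
Qed.

Lemma derivable_continuous (k : C -> C) z : derivable k z 1 -> {for z, continuous k}.
Proof. by move=> /derivable1_diffP; exact: differentiable_continuous. Qed.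

Definition on_frame (a b c d : R) (P : C -> Prop) : Prop :=
  (forall x, a <= x <= b -> P (x +i* c) /\ P (x +i* d)) /\
  (forall y, c <= y <= d -> P (a +i* y) /\ P (b +i* y)).

(** The counterclockwise integral. Each pair of opposite sides is put under one integral
    sign: for an affine integrand, the resulting integrands are constant. *)
Definition rectint (k : C -> C) (a b c d : R) : C :=
  cint (fun x => k (x +i* c) - k (x +i* d)) a b
  + 'i * cint (fun y => k (b +i* y) - k (a +i* y)) c d.

Definition continuous_on_frame (k : C -> C) (a b c d : R) : Prop :=
  on_frame a b c d (fun z => {for z, continuous k}).

Lemma continuous_horizontal (k : C -> C) x y :
  {for (x +i* y : C), continuous k} -> {for x, continuous (fun t : R => k (t +i* y))}.
Proof.
move=> kc; apply: (cvg_comp (fun t : R => t +i* y : C) k _ kc).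
by apply/cvg_ReIm; split => /=; [exact: cvg_id | exact: cvg_cst].
Qed.

Lemma continuous_vertical (k : C -> C) x y :
  {for (x +i* y : C), continuous k} -> {for y, continuous (fun t : R => k (x +i* t))}.
Proof.
move=> kc; apply: (cvg_comp (fun t : R => x +i* t : C) k _ kc).
by apply/cvg_ReIm; split => /=; [exact: cvg_cst | exact: cvg_id].
Qed.

Lemma continuous_frame_sides k a b c d : continuous_on_frame k a b c d ->
  [/\ continuous_on_segment (fun x => k (x +i* c)) a b,
      continuous_on_segment (fun x => k (x +i* d)) a b,
      continuous_on_segment (fun y => k (a +i* y)) c d &
      continuous_on_segment (fun y => k (b +i* y)) c d].
Proof.
move=> [hor ver]; split=> t tab.
- exact: continuous_horizontal (hor _ tab).1.
- exact: continuous_horizontal (hor _ tab).2.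
- exact: continuous_vertical (ver _ tab).1.
- exact: continuous_vertical (ver _ tab).2.
Qed.

Lemma eq_rectint (k l : C -> C) a b c d : on_frame a b c d (fun z => k z = l z) ->
  rectint k a b c d = rectint l a b c d.
Proof.
move=> [hor ver]; rewrite /rectint; congr (_ + _ * _); apply: eq_cint => t tab.
  by have [-> ->] := hor _ tab.
by have [-> ->] := ver _ tab.
Qed.

Lemma rectintD k l a b c d : continuous_on_frame k a b c d -> continuous_on_frame l a b c d ->
  rectint (fun z => k z + l z) a b c d = rectint k a b c d + rectint l a b c d.
Proof.
move=> /continuous_frame_sides[k1 k2 k3 k4] /continuous_frame_sides[l1 l2 l3 l4].
rewrite /rectint addrACA -mulrDr; congr (_ + _ * _).
  rewrite -cintD; [|exact: continuous_on_segmentB..].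
  by apply: eq_cint => t _; rewrite opprD addrACA.
rewrite -cintD; [|exact: continuous_on_segmentB..].
by apply: eq_cint => t _; rewrite opprD addrACA.
Qed.

Lemma rectintZ u k a b c d : continuous_on_frame k a b c d ->
  rectint (fun z => u * k z) a b c d = u * rectint k a b c d.
Proof.
move=> /continuous_frame_sides[k1 k2 k3 k4].
rewrite /rectint mulrDr mulrCA; congr (_ + _ * _).
  rewrite -cintZ; last exact: continuous_on_segmentB.
  by apply: eq_cint => t _; rewrite mulrBr.
rewrite -cintZ; last exact: continuous_on_segmentB.
by apply: eq_cint => t _; rewrite mulrBr.
Qed.

Lemma continuous_scalel (u : C) (k : C -> C) z :
  {for z, continuous k} -> {for z, continuous (fun w => u * k w)}.
Proof. by move=> kc; apply: continuousM; [exact: cst_continuous | exact: kc]. Qed.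

Lemma continuous_on_frameZ u k a b c d : continuous_on_frame k a b c d ->
  continuous_on_frame (fun z => u * k z) a b c d.
Proof.
move=> [hor ver]; split=> t tab.
  have [c1 c2] := hor _ tab; split.
    exact: continuous_scalel c1.
  exact: continuous_scalel c2.
have [c1 c2] := ver _ tab; split.
  exact: continuous_scalel c1.
exact: continuous_scalel c2.
Qed.

Lemma rectintB k l a b c d : continuous_on_frame k a b c d -> continuous_on_frame l a b c d ->
  rectint (fun z => k z - l z) a b c d = rectint k a b c d - rectint l a b c d.
Proof.
move=> kc lc; have -> : rectint (fun z => k z - l z) a b c d =
    rectint (fun z => k z + (-1) * l z) a b c d.
  by apply: eq_rectint; split=> t _; rewrite !mulN1r.
rewrite rectintD; [|exact: kc|exact: continuous_on_frameZ].
by rewrite rectintZ; [rewrite mulN1r|exact: lc].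
Qed.

Lemma continuous_on_frameB k l a b c d : continuous_on_frame k a b c d ->
  continuous_on_frame l a b c d -> continuous_on_frame (fun z => k z - l z) a b c d.
Proof.
move=> [khor kver] [lhor lver]; split=> t tab.
  have [[k1 k2] [l1 l2]] := (khor _ tab, lhor _ tab).
  by split; [exact: (continuousB k1 l1)|exact: (continuousB k2 l2)].
have [[k1 k2] [l1 l2]] := (kver _ tab, lver _ tab).
by split; [exact: (continuousB k1 l1)|exact: (continuousB k2 l2)].
Qed.

(** Both pairs of opposite sides contribute, up to sign, [v] times ['i] times the area. *)
Lemma rectint_affine (u v : C) a b c d : a <= b -> c <= d ->
  rectint (fun z => u + v * z) a b c d = 0.
Proof.
move=> ab cd; rewrite /rectint.
rewrite (@eq_cint _ _ (fun=> v * (0 +i* (c - d)))); last first.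
  by move=> t _; rewrite opprD addrACA subrr add0r -mulrBr; congr (_ * _); simpc.
rewrite cint_cst // (@eq_cint _ _ (fun=> v * (b - a)%:C)); last first.
  by move=> t _; rewrite opprD addrACA subrr add0r -mulrBr; congr (_ * _); simpc.
rewrite cint_cst //; case: v => v1 v2; simpc.
by apply/eqP; rewrite eq_complex /=; apply/andP; split; apply/eqP; ring.
Qed.

Lemma rectint_bound k a b c d (M : R) : a <= b -> c <= d -> continuous_on_frame k a b c d ->
  on_frame a b c d (fun z => modc (k z) <= M) ->
  modc (rectint k a b c d) <= 4 * M * ((b - a) + (d - c)).
Proof.
move=> ab cd /continuous_frame_sides[k1 k2 k3 k4] [hor ver].
apply: le_trans (modcD _ _) _; rewrite modcM modc_i mul1r mulrDr; apply: lerD.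
  have -> : 4 * M * (b - a) = 2 * ((M + M) * (b - a)) by ring.
  apply: cint_bound; [exact: ab|exact: continuous_on_segmentB|].
  by move=> t /hor[? ?]; apply: le_trans (modcB _ _) (lerD _ _).
have -> : 4 * M * (d - c) = 2 * ((M + M) * (d - c)) by ring.
apply: cint_bound; [exact: cd|exact: continuous_on_segmentB|].
by move=> t /ver[? ?]; apply: le_trans (modcB _ _) (lerD _ _).
Qed.

Lemma rectint_vsplit k a m b c d : a <= m -> m <= b ->
  continuous_on_frame k a m c d -> continuous_on_frame k m b c d ->
  rectint k a b c d = rectint k a m c d + rectint k m b c d.
Proof.
move=> am mb k1 k2.
have [h1 h2 v1 v2] := continuous_frame_sides k1.
have [_ _ v3 v4] := continuous_frame_sides k2.
have hor : continuous_on_segment (fun x => k (x +i* c) - k (x +i* d)) a b.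
  move=> t /andP[at_ tb]; have [tm|/ltW mt] := leP t m.
    have kc := k1.1 t; rewrite at_ tm in kc; have [c1 c2] := kc isT.
    apply: continuousB; [exact: continuous_horizontal c1 | exact: continuous_horizontal c2].
  have kc := k2.1 t; rewrite mt tb in kc; have [c1 c2] := kc isT.
    apply: continuousB; [exact: continuous_horizontal c1 | exact: continuous_horizontal c2].
rewrite /rectint (cint_cat am mb hor) addrACA -mulrDr -cintD;
  [|exact: continuous_on_segmentB..].
by congr (_ + _ * _); apply: eq_cint => t _; ring.
Qed.

Lemma rectint_hsplit k a b c m d : c <= m -> m <= d ->
  continuous_on_frame k a b c m -> continuous_on_frame k a b m d ->
  rectint k a b c d = rectint k a b c m + rectint k a b m d.
Proof.
move=> cm md k1 k2.
have [h1 h2 v1 v2] := continuous_frame_sides k1.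
have [h3 h4 _ _] := continuous_frame_sides k2.
have ver : continuous_on_segment (fun y => k (b +i* y) - k (a +i* y)) c d.
  move=> t /andP[ct td]; have [tm|/ltW mt] := leP t m.
    have kc := k1.2 t; rewrite ct tm in kc; have [c1 c2] := kc isT.
    apply: continuousB; [exact: continuous_vertical c2 | exact: continuous_vertical c1].
  have kc := k2.2 t; rewrite mt td in kc; have [c1 c2] := kc isT.
    apply: continuousB; [exact: continuous_vertical c2 | exact: continuous_vertical c1].
rewrite /rectint (cint_cat cm md ver) addrACA -mulrDr -cintD;
  [|exact: continuous_on_segmentB..].
by congr (_ + _ * _); apply: eq_cint => t _; ring.
Qed.

End RectangleIntegral.

(** * Goursat's theorem *)

Section Goursat.
Variable R : realType.
Local Notation C := (Cplx R).
Local Notation modc := (@ComplexField.Normc.normc R).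

Record derivable_on_rect (k : C -> C) (a b c d : R) : Prop := DerivableOnRect {
  derivable_rect : forall x y, a <= x <= b -> c <= y <= d -> derivable k (x +i* y : C) 1
}.

Lemma derivable_on_subrect k a b c d a' b' c' d' :
  a <= a' -> b' <= b -> c <= c' -> d' <= d ->
  derivable_on_rect k a b c d -> derivable_on_rect k a' b' c' d'.
Proof.
move=> aa bb cc dd kd; split=> x y /andP[ax xb] /andP[cy yd]; apply: (derivable_rect kd).
  by rewrite (le_trans aa ax) (le_trans xb bb).
by rewrite (le_trans cc cy) (le_trans yd dd).
Qed.

Lemma derivable_continuous_on_frame k a b c d : a <= b -> c <= d ->
  derivable_on_rect k a b c d -> continuous_on_frame k a b c d.
Proof.
move=> ab cd kd; split=> t tab; split; apply: derivable_continuous; apply: (derivable_rect kd);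
  by rewrite ?lexx ?ab ?cd ?tab.
Qed.

Lemma dist_in_segment (a w x y : R) :
  a <= x <= a + w -> a <= y <= a + w -> `|x - y| <= w.
Proof.
by move=> /andP[x1 x2] /andP[y1 y2]; rewrite ler_norml; apply/andP; split; lra.
Qed.

Lemma scaled_square_le (e s : R) : 0 <= s -> 0 < e ->
  4 * (e / (4 * (s + 1) ^+ 2)) * s ^+ 2 <= e.
Proof.
move=> s0 e0; have s1 : 0 < (s + 1) ^+ 2 by rewrite exprn_gt0 // ltr_wpDl.
have -> : 4 * (e / (4 * (s + 1) ^+ 2)) * s ^+ 2 = e * (s ^+ 2 / (s + 1) ^+ 2).
  by field; rewrite gt_eqF // ltr_wpDl.
rewrite ger_pMr // ler_pdivrMr // mul1r; nra.
Qed.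

Lemma sum_of_quarters (x y z t s : R) : 4 * x < s -> 4 * y < s -> 4 * z < s ->
  4 * t < s -> x + y + (z + t) < s.
Proof. lra. Qed.

(** The integral is the sum of those over the four quarters, so one of them is at least
    a fourth of it in modulus. *)
Lemma rectint_quarter k a w c h : 0 <= w -> 0 <= h ->
  derivable_on_rect k a (a + w) c (c + h) ->
  exists a' c', [/\ a <= a', a' + w / 2 <= a + w, c <= c', c' + h / 2 <= c + h &
    modc (rectint k a (a + w) c (c + h)) <=
      4 * modc (rectint k a' (a' + w / 2) c' (c' + h / 2))].
Proof.
move=> w0 h0.
have am : a <= a + w / 2 by rewrite lerDl divr_ge0.
have cl : c <= c + h / 2 by rewrite lerDl divr_ge0.
have mE : a + w / 2 + w / 2 = a + w by rewrite -addrA -splitr.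
have lE : c + h / 2 + h / 2 = c + h by rewrite -addrA -splitr.
have mb : a + w / 2 <= a + w by rewrite -mE lerDl divr_ge0.
have ld : c + h / 2 <= c + h by rewrite -lE lerDl divr_ge0.
move: am cl mE lE mb ld; move amE: (a + w / 2) => m; move clE: (c + h / 2) => l.
move: (a + w) (c + h) => b d am cl mE lE mb ld kd.
have cont a' b' c' d' : a <= a' -> a' <= b' -> b' <= b -> c <= c' -> c' <= d' -> d' <= d ->
    continuous_on_frame k a' b' c' d'.
  move=> h1 h2 h3 h4 h5 h6; apply: derivable_continuous_on_frame => //.
  exact: derivable_on_subrect kd.
have cd : c <= d by exact: le_trans ld.
have ab : a <= b by exact: le_trans mb.
have splitE : rectint k a b c d =
    (rectint k a m c l + rectint k a m l d) + (rectint k m b c l + rectint k m b l d).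
  rewrite (rectint_vsplit am mb); [|exact: cont..].
  rewrite (rectint_hsplit cl ld); [|exact: cont..].
  by rewrite (rectint_hsplit (k := k) (a := m) cl ld); [|exact: cont..].
set I := modc (rectint k a b c d).
have I_le : I <= (modc (rectint k a m c l) + modc (rectint k a m l d)) +
                 (modc (rectint k m b c l) + modc (rectint k m b l d)).
  rewrite /I splitE; apply: le_trans (modcD _ _) _.
  by apply: lerD; exact: modcD.
have [I1|I1] := leP I (4 * modc (rectint k a m c l)); first by exists a, c; rewrite amE clE.
have [I2|I2] := leP I (4 * modc (rectint k a m l d)).
  by exists a, l; rewrite amE lE lexx.
have [I3|I3] := leP I (4 * modc (rectint k m b c l)).
  by exists m, c; rewrite mE clE lexx.
have [I4|I4] := leP I (4 * modc (rectint k m b l d)).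
  by exists m, l; rewrite mE lE !lexx.
by have := le_lt_trans I_le (sum_of_quarters I1 I2 I3 I4); rewrite ltxx.
Qed.

(** Bisection: a nonzero integral would survive, up to a factor [4 ^ n], in nested
    rectangles shrinking to a point, where the first-order expansion of the integrand
    contradicts this, integrals of affine functions being zero. *)
Theorem goursat k a b c d : a <= b -> c <= d -> derivable_on_rect k a b c d ->
  rectint k a b c d = 0.
Proof.
move=> ab cd kd.
have [w [w0 wS wE]] : exists w : nat -> R,
    [/\ w 0%N = b - a, forall n, w n.+1 = w n / 2 & forall n, w n = (b - a) / 2 ^+ n].
  exists (fun n => (b - a) / 2 ^+ n).
  by split=> // [|n]; rewrite ?expr0 ?divr1 // exprSr invfM mulrA.
have [h [h0 hS hE]] : exists h : nat -> R,
    [/\ h 0%N = d - c, forall n, h n.+1 = h n / 2 & forall n, h n = (d - c) / 2 ^+ n].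
  exists (fun n => (d - c) / 2 ^+ n).
  by split=> // [|n]; rewrite ?expr0 ?divr1 // exprSr invfM mulrA.
have w_ge0 n : 0 <= w n by rewrite wE divr_ge0 ?subr_ge0 ?exprn_ge0.
have h_ge0 n : 0 <= h n by rewrite hE divr_ge0 ?subr_ge0 ?exprn_ge0.
pose inside n (p : R * R) := [/\ a <= p.1, p.1 + w n <= b, c <= p.2 & p.2 + h n <= d].
pose I n (p : R * R) := modc (rectint k p.1 (p.1 + w n) p.2 (p.2 + h n)).
pose good n (p q : R * R) := [/\ p.1 <= q.1, q.1 + w n.+1 <= p.1 + w n,
   p.2 <= q.2, q.2 + h n.+1 <= p.2 + h n & I n p <= 4 * I n.+1 q].
have /choice[f fP] : forall np : nat * (R * R), exists q,
    inside np.1 np.2 -> good np.1 np.2 q.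
  move=> [n p] /=; have [[i1 i2 i3 i4]|ni] := pselect (inside n p); last by exists p.
  have kd' : derivable_on_rect k p.1 (p.1 + w n) p.2 (p.2 + h n).
    exact: derivable_on_subrect kd.
  have [a' [c' [q1 q2 q3 q4 q5]]] := rectint_quarter (w_ge0 n) (h_ge0 n) kd'.
  by exists (a', c') => _; split; rewrite /I /= ?wS ?hS.
pose s := fix s n := if n is m.+1 then f (m, s m) else (a, c).
have s_in n : inside n (s n).
  elim: n => [|n IH]; first by split; rewrite /= ?lexx // ?w0 ?h0 addrC subrK.
  have [g1 g2 g3 g4 _] := fP (n, s n) IH.
  have [i1 i2 i3 i4] := IH.
  split; [exact: le_trans g1|exact: le_trans i2|exact: le_trans g3|exact: le_trans i4].
have s_good n : good n (s n) (s n.+1) by exact: (fP (n, s n) (s_in n)).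
have s_mono n m : (n <= m)%N -> [/\ (s n).1 <= (s m).1, (s m).1 + w m <= (s n).1 + w n,
    (s n).2 <= (s m).2 & (s m).2 + h m <= (s n).2 + h n].
  elim: m => [|m IH]; first by rewrite leqn0 => /eqP ->; split.
  rewrite leq_eqVlt => /orP[/eqP ->|]; first by split.
  rewrite ltnS => /IH[m1 m2 m3 m4]; have [g1 g2 g3 g4 _] := s_good m.
  split; [exact: le_trans g1|exact: le_trans m2|exact: le_trans g3|exact: le_trans m4].
have below n m : (s m).1 <= (s n).1 + w n /\ (s m).2 <= (s n).2 + h n.
  have [nm|/ltnW mn] := leqP n m.
    have [_ m2 _ m4] := s_mono _ _ nm.
    by split; [apply: le_trans m2|apply: le_trans m4]; rewrite lerDl.
  have [m1 _ m3 _] := s_mono _ _ mn.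
  by split; [apply: le_trans m1 _|apply: le_trans m3 _]; rewrite lerDl.
pose X := sup (range (fun n => (s n).1)); pose Y := sup (range (fun n => (s n).2)).
have Xn n : (s n).1 <= X <= (s n).1 + w n.
  apply/andP; split.
    apply: ub_le_sup; last by exists n.
    by exists (a + w 0%N) => _ [m _ <-]; have [] := below 0%N m.
  by apply: ge_sup; [exists (s 0%N).1, 0%N | move=> _ [m _ <-]; have [] := below n m].
have Yn n : (s n).2 <= Y <= (s n).2 + h n.
  apply/andP; split.
    apply: ub_le_sup; last by exists n.
    by exists (c + h 0%N) => _ [m _ <-]; have [] := below 0%N m.
  by apply: ge_sup; [exists (s 0%N).2, 0%N | move=> _ [m _ <-]; have [] := below n m].
have I0 n : I 0%N (s 0%N) <= 4 ^+ n * I n (s n).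
  elim: n => [|n IH]; first by rewrite expr0 mul1r.
  have [_ _ _ _ g5] := s_good n.
  by apply: le_trans IH _; rewrite exprSr -mulrA ler_wpM2l // exprn_ge0.
have rectE : modc (rectint k a b c d) = I 0%N (s 0%N).
  by rewrite /I /= w0 h0 !(addrC _ (_ - _)) !subrK.
have /derivableP/is_derive_modcP kz : derivable k (X +i* Y : C) 1.
  have [i1 i2 i3 i4] := s_in 0%N; have [/andP[x1 x2] /andP[y1 y2]] := (Xn 0%N, Yn 0%N).
  by apply: (derivable_rect kd); apply/andP; split=> //; [exact: le_trans i2|exact: le_trans i4].
set D := 'D_1 k _ in kz.
set L := (b - a) + (d - c).
have L_ge0 : 0 <= L by rewrite addr_ge0 // subr_ge0.
apply: modc_small => e e0.
(* At level [n] the error is at most [4 * eta * (L / 2 ^+ n) ^+ 2], so [4 ^+ n] times it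
   is [4 * eta * L ^+ 2], which this [eta] brings below [e]. *)
pose eta := e / (4 * (L + 1) ^+ 2).
have eta0 : 0 < eta.
  by rewrite divr_gt0 // mulr_gt0 // exprn_gt0 // ltr_wpDl.
have [delta d0 kexp] := kz _ eta0.
have [n nL] : exists n, L / 2 ^+ n < delta.
  exists (Num.Def.archi_bound (L / delta)).
  rewrite ltr_pdivrMr ?exprn_gt0 // -ltr_pdivrMl // mulrC.
  apply: lt_trans (archi_boundP _) _; first by rewrite divr_ge0 // ltW.
  by rewrite -natrX ltr_nat ltn_expl.
have [i1 i2 i3 i4] := s_in n.
have expand x y : (s n).1 <= x <= (s n).1 + w n -> (s n).2 <= y <= (s n).2 + h n ->
    modc (k (x +i* y) - (k (X +i* Y) - D * (X +i* Y) + D * (x +i* y))) <=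
    eta * (L / 2 ^+ n).
  move=> /andP[x1 x2] /andP[y1 y2].
  have dist : modc ((x +i* y) - (X +i* Y) : C) <= L / 2 ^+ n.
    apply: le_trans (modc_le_ReIm _) _; rewrite /L mulrDl -wE -hE.
    rewrite -[_ - _]/((x - X) +i* (y - Y)) /=; apply: lerD.
      by apply: dist_in_segment (Xn n); rewrite x1.
    by apply: dist_in_segment (Yn n); rewrite y1.
  have := kexp ((x +i* y) - (X +i* Y)) (le_lt_trans dist nL).
  have -> : (X +i* Y : C) + (x +i* y - (X +i* Y)) *: (1 : C) = x +i* y.
    by rewrite [_ *: _]mulr1 [LHS]addrC subrK.
  move=> kxy.
  have -> : k (x +i* y) - (k (X +i* Y) - D * (X +i* Y) + D * (x +i* y)) =
      k (x +i* y) - k (X +i* Y) - (x +i* y - (X +i* Y)) * D by ring.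
  by apply: le_trans kxy _; rewrite ler_pM2l.
have kc : continuous_on_frame k (s n).1 ((s n).1 + w n) (s n).2 ((s n).2 + h n).
  apply: derivable_continuous_on_frame; rewrite ?lerDl //.
  exact: derivable_on_subrect kd.
pose A (z : C) : C := k (X +i* Y) - D * (X +i* Y) + D * z.
have Ac : continuous_on_frame A (s n).1 ((s n).1 + w n) (s n).2 ((s n).2 + h n).
  apply: derivable_continuous_on_frame; [by rewrite lerDl|by rewrite lerDl|].
  split=> x y _ _.
  apply: derivableD; first exact: derivable_cst.
  by apply: derivableM; [exact: derivable_cst|exact: derivable_id].
have I_le : I n (s n) <= 4 * (eta * (L / 2 ^+ n)) * (w n + h n).
  rewrite /I -[rectint _ _ _ _ _]subr0.
  rewrite -(@rectint_affine R (k (X +i* Y) - D * (X +i* Y)) D (s n).1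
    ((s n).1 + w n) (s n).2 ((s n).2 + h n)) ?lerDl //.
  rewrite -rectintB; [|exact: kc|exact: Ac].
  have -> : w n + h n = ((s n).1 + w n - (s n).1) + ((s n).2 + h n - (s n).2).
    by rewrite !(addrAC _ _ (- _)) !subrr !add0r.
  have sx : (s n).1 <= (s n).1 + w n by rewrite lerDl.
  have sy : (s n).2 <= (s n).2 + h n by rewrite lerDl.
  apply: (rectint_bound sx sy (continuous_on_frameB kc Ac)).
  by split=> t tt; split; apply: expand; rewrite ?tt ?lexx ?sx ?sy.
rewrite rectE; apply: le_trans (I0 n) _.
apply: le_trans (ler_wpM2l _ I_le) _; first exact: exprn_ge0.
have -> : 4 ^+ n * (4 * (eta * (L / 2 ^+ n)) * (w n + h n)) = 4 * eta * L ^+ 2.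
  rewrite wE hE -mulrDl -/L (_ : 4 = 2 * 2 :> R); last by rewrite -natrM.
  rewrite exprMn; field; exact: expf_neq0.
exact: scaled_square_le.
Qed.

End Goursat.

(** * Cauchy's formula on squares *)

Section CauchyFormula.
Variable R : realType.
Local Notation C := (Cplx R).
Local Notation Re := complex.Re.
Local Notation Im := complex.Im.
Local Notation modc := (@ComplexField.Normc.normc R).

Record derivable_on_punctured_square (k : C -> C) (r : R) : Prop := DerivableOnPunctured {
  derivable_punctured : forall x y : R, (x != 0) || (y != 0) ->
    - r <= x <= r -> - r <= y <= r -> derivable k (x +i* y : C) 1
}.

Definition squareint (k : C -> C) (r : R) : C := rectint k (- r) r (- r) r.

Lemma punctured_continuous_on_frame k r a b c d : derivable_on_punctured_square k r ->
  a != 0 -> b != 0 -> c != 0 -> d != 0 ->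
  - r <= a -> a <= b -> b <= r -> - r <= c -> c <= d -> d <= r ->
  continuous_on_frame k a b c d.
Proof.
move=> kd a0 b0 c0 d0 ra ab br rc cd dr.
have inx t : a <= t <= b -> - r <= t <= r.
  by move=> /andP[at_ tb]; rewrite (le_trans ra at_) (le_trans tb br).
have iny t : c <= t <= d -> - r <= t <= r.
  by move=> /andP[ct td]; rewrite (le_trans rc ct) (le_trans td dr).
split=> t tt; split; apply: derivable_continuous; apply: (derivable_punctured kd);
  do ?[by rewrite ?a0 ?b0 ?c0 ?d0 ?orbT | exact: inx | exact: iny].
- by apply: iny; rewrite lexx.
- by apply: iny; rewrite lexx cd.
- by apply: inx; rewrite lexx.
- by apply: inx; rewrite lexx ab.
Qed.

Lemma punctured_derivable_on_rect k r a b c d : derivable_on_punctured_square k r ->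
  [|| 0 < a, b < 0, 0 < c | d < 0] ->
  - r <= a -> b <= r -> - r <= c -> d <= r ->
  derivable_on_rect k a b c d.
Proof.
move=> kd off0 ra br rc dr; split=> x y /andP[ax xb] /andP[cy yd].
apply: (derivable_punctured kd).
- case/or4P: off0 => s.
  + by rewrite gt_eqF // (lt_le_trans s).
  + by rewrite lt_eqF // (le_lt_trans xb).
  + by rewrite (@gt_eqF _ _ y) ?orbT // (lt_le_trans s).
  + by rewrite (@lt_eqF _ _ y) ?orbT // (le_lt_trans yd).
- by rewrite (le_trans ra ax) (le_trans xb br).
- by rewrite (le_trans rc cy) (le_trans yd dr).
Qed.

(** The region between two concentric squares is the union of four rectangles. *)
Lemma squareint_shrink k e r : 0 < e -> e <= r -> derivable_on_punctured_square k r ->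
  squareint k r = squareint k e.
Proof.
move=> e0 er kd; have r0 : 0 < r by exact: lt_le_trans er.
have re : - r <= - e by rewrite lerN2.
have ee : - e <= e by rewrite ge0_cp // ltW.
have rr : - r <= r by rewrite ge0_cp // ltW.
have ner : - e <= r by exact: le_trans er.
have rne : - r <= e by exact: le_trans ee.
have ne0 : - e < 0 by rewrite oppr_lt0.
have [en0 rn0] : e != 0 /\ r != 0 by rewrite !gt_eqF.
have [nen0 nrn0] : - e != 0 /\ - r != 0 by rewrite !oppr_eq0.
have fr a b c d := @punctured_continuous_on_frame k r a b c d kd.
have z a b c d : a <= b -> c <= d -> [|| 0 < a, b < 0, 0 < c | d < 0] ->
    - r <= a -> b <= r -> - r <= c -> d <= r -> rectint k a b c d = 0.
  move=> ab cd off0 ra br rc dr; apply: goursat => //.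
  exact: punctured_derivable_on_rect off0 ra br rc dr.
rewrite /squareint.
rewrite (rectint_hsplit (k := k) (m := - e) re ner); [|exact: fr..].
rewrite (z _ _ (- r)) ?ne0 ?orbT // add0r.
rewrite (rectint_hsplit (k := k) (m := e) ee er); [|exact: fr..].
rewrite (z _ _ e) ?e0 ?orbT // addr0.
rewrite (rectint_vsplit (k := k) (m := - e) re ner); [|exact: fr..].
rewrite (z (- r)) ?ne0 ?orbT // add0r.
rewrite (rectint_vsplit (k := k) (m := e) ee er); [|exact: fr..].
by rewrite (z e) ?e0 // addr0.
Qed.

Lemma inv_derivable (z : C) : z != 0 -> derivable (fun w : C => w^-1) z 1.
Proof. by move=> z0; apply: derivableV => //; exact: derivable_id. Qed.

Lemma inv_sqr_derivable (z : C) : z != 0 -> derivable (fun w : C => w ^- 2) z 1.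
Proof.
move=> z0; have -> : (fun w : C => w ^- 2) = (fun w => w^-1) * (fun w => w^-1).
  by apply/funext => w; exact: invfM.
exact: (derivableM (inv_derivable z0) (inv_derivable z0)).
Qed.

Lemma complex_neq0 (x y : R) : (x != 0) || (y != 0) -> (x +i* y : C) != 0.
Proof. by rewrite eq_complex /= negb_and. Qed.

Lemma inv_derivable_on_punctured_square r :
  derivable_on_punctured_square (fun w : C => w^-1) r.
Proof. by split=> x y xy _ _; apply: inv_derivable; exact: complex_neq0. Qed.

(** The integral of [z^-1] around 0, that is, [2 i pi]. *)
Definition square_period : C := squareint (fun w : C => w^-1) 1.

(** The integrals over opposite sides add up to real integrals: the period is [2 * 'i] times
    the integral of [2 / (1 + t ^+ 2)] over the segment from -1 to 1. *)
Lemma square_period_neq0 : square_period != 0.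
Proof.
pose f (t : R) : C := (2 / (1 + t ^+ 2))%:C.
have den t : 1 + t ^+ 2 != 0 :> R by rewrite gt_eqF // ltr_pwDl // sqr_ge0.
have sum_inv (t : R) : (1 +i* t : C)^-1 - (-1 +i* t)^-1 = f t.
  have -> : (-1 +i* t : C)^-1 = - (1 -i* t)^-1.
    by rewrite -invrN; congr (_^-1); simpc.
  rewrite opprK /f; apply/eqP; rewrite eq_complex /= sqrrN expr1n.
  by apply/andP; split; apply/eqP; field.
have dif_inv (t : R) : (t -i* 1 : C)^-1 - (t +i* 1)^-1 = 'i * f t.
  apply/eqP; rewrite eq_complex /= sqrrN expr1n addrC.
  apply/andP; split; apply/eqP; field; rewrite ?den //.
have r1 : -1 <= 1 :> R by rewrite ge0_cp.
have fc : continuous_on_segment f (-1) 1.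
  have invc (x y : R) : (x != 0) || (y != 0) ->
      {for (x +i* y : C), continuous (fun w : C => w^-1)}.
    by move=> xy; apply/derivable_continuous/inv_derivable; exact: complex_neq0.
  move=> t _; have -> : f = (fun t : R => (1 +i* t : C)^-1 - (-1 +i* t)^-1).
    by apply/funext => u; rewrite sum_inv.
  have c1 : {for (1 +i* t : C), continuous (fun w : C => w^-1)}.
    by apply: invc; rewrite oner_eq0.
  have c2 : {for (-1 +i* t : C), continuous (fun w : C => w^-1)}.
    by apply: invc; rewrite oppr_eq0 oner_eq0.
  exact: (continuousB (continuous_vertical c1) (continuous_vertical c2)).
have -> : square_period = (2 * 'i) * cint f (-1) 1.
  rewrite /square_period /squareint /rectint.
  rewrite (@eq_cint _ _ (fun t => 'i * f t)); last by move=> t _; rewrite -dif_inv.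
  rewrite cintZ // (@eq_cint _ _ f); last by move=> t _; rewrite -sum_inv.
  by rewrite -mulrA mulr_natl mulr2n.
apply: mulf_neq0.
  by apply: mulf_neq0; [rewrite pnatr_eq0|rewrite eq_complex /= oner_eq0 andbF].
have [fi _] := integrable_ReIm fc.
apply/eqP => /(congr1 (@complex.Re R)) /= f0.
have : \int[@lebesgue_measure R]_(t in `[(-1 : R), 1]) (1 : R) <= 0.
  rewrite -f0; apply: le_Rintegral; [exact: measurable_itv| |exact: fi|].
    apply: continuous_compact_integrable; first exact: segment_compact.
    by apply: continuous_subspaceT => t; exact: cvg_cst.
  move=> t; rewrite /= in_itv /= => /andP[t1 t2].
  by rewrite ler_pdivlMr ?mul1r; [nra|rewrite ltr_pwDl // sqr_ge0].
rewrite Rintegral_segment_cst // mul1r opprK => ?; lra.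
Qed.

Lemma on_frame_impl a b c d (P Q : C -> Prop) : (forall z, P z -> Q z) ->
  on_frame a b c d P -> on_frame a b c d Q.
Proof.
move=> PQ [hor ver]; split=> t /[dup] tt.
  by move=> /hor[p1 p2]; split; exact: PQ.
by move=> /ver[p1 p2]; split; exact: PQ.
Qed.

Lemma square_frame_modc e : 0 < e ->
  on_frame (- e) e (- e) e (fun z => e <= modc z <= 2 * e).
Proof.
move=> e0; have en : `|e| = e by rewrite gtr0_norm.
have main x y : - e <= x <= e -> - e <= y <= e -> `|x| = e \/ `|y| = e ->
    e <= modc (x +i* y) <= 2 * e.
  rewrite -!ler_norml => xe ye xy; apply/andP; split.
    by case: xy => <-; [exact: (Re_le_modc (x +i* y))|exact: (Im_le_modc (x +i* y))].
  by apply: le_trans (modc_le_ReIm _) _; rewrite mulr_natl mulr2n lerD.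
have ee : - e <= e <= e by rewrite lexx ge0_cp // ltW.
have nee : - e <= - e <= e by rewrite lexx ge0_cp // ltW.
by split=> t tt; split; apply: main => //; rewrite ?normrN; auto.
Qed.

Lemma square_frame_neq0 e (z : C) : 0 < e -> e <= modc z <= 2 * e -> z != 0.
Proof.
move=> e0 /andP[ez _]; apply/eqP => z0; move: ez.
by rewrite z0 ComplexField.Normc.normc0 leNgt e0.
Qed.

(** Cauchy's formula for the first derivative at the centre of a square. The constant
    [h 0] is subtracted so that only the integral of [z^-1] over a square is needed. By
    Goursat's theorem the square may be shrunk to 0, where the integrand is [D / z] up to
    an error that is small compared with [z^-1]. *)
Theorem cauchy_derivative (h : C -> C) (r : R) (D : C) : 0 < r ->
  derivable_on_rect h (- r) r (- r) r -> is_derive (0 : C) 1 h D ->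
  squareint (fun z => (h z - h 0) / z ^+ 2) r = D * square_period.
Proof.
move=> r0 hd hD.
pose k (z : C) := (h z - h 0) / z ^+ 2.
have kd : derivable_on_punctured_square k r.
  split=> x y /complex_neq0 xy xr yr; apply: derivableM.
    by apply: derivableB; [exact: (derivable_rect hd)|exact: derivable_cst].
  exact: inv_sqr_derivable.
apply/eqP; rewrite -subr_eq0; apply/eqP/modc_small => eta eta0.
have [|delta d0 hexp] := (is_derive_modcP _ _ _ _).1 hD (eta / 16).
  by rewrite divr_gt0.
(* Moduli on the frame of this square are at most [2 * e < delta], and the unit square of
   [square_period] can be shrunk to it. *)
pose e := Num.min (Num.min 1 r) (delta / 4).
have e0 : 0 < e by rewrite !lt_min ltr01 r0 divr_gt0.
have er : e <= r by rewrite !ge_min lexx orbT.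
have e1 : e <= 1 by rewrite !ge_min lexx.
have ed : 2 * e < delta.
  have : e <= delta / 4 by rewrite ge_min lexx orbT.
  by clear -d0; lra.
rewrite (squareint_shrink e0 er kd) /square_period.
rewrite (squareint_shrink e0 e1 (inv_derivable_on_punctured_square 1)).
have ee : - e <= e by rewrite ge0_cp // ltW.
have cf (l : C -> C) : (forall z, z != 0 -> {for z, continuous l}) ->
    continuous_on_frame l (- e) e (- e) e.
  move=> lc; apply: on_frame_impl (square_frame_modc e0) => z.
  by move=> /(square_frame_neq0 e0); exact: lc.
have invc : continuous_on_frame (fun w : C => w^-1) (- e) e (- e) e.
  by apply: cf => z z0; exact/derivable_continuous/inv_derivable.
have kc : continuous_on_frame k (- e) e (- e) e.
  have [e0n] : e != 0 /\ - e != 0 by rewrite oppr_eq0 gt_eqF.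
  by move=> ?; apply: (punctured_continuous_on_frame kd); rewrite ?lerN2.
have Dc := continuous_on_frameZ D invc.
have -> : squareint k e - D * squareint (fun w : C => w^-1) e =
    rectint (fun z => k z - D * z^-1) (- e) e (- e) e.
  by rewrite (rectintB kc Dc) (rectintZ D invc).
have -> : eta = 4 * (eta / 16 / e) * ((e - - e) + (e - - e)).
  by field; rewrite gt_eqF.
apply: (rectint_bound ee ee (continuous_on_frameB kc Dc)).
apply: on_frame_impl (square_frame_modc e0) => z ze.
have z0 := square_frame_neq0 e0 ze; case/andP: ze => ez ze.
have -> : k z - D * z^-1 = (h (0 + z *: 1) - h 0 - z * D) / z ^+ 2.
  by rewrite add0r [_ *: _]mulr1 /k; field.
rewrite modcM modcV ler_pdivrMr; last by rewrite modc_gt0 // expf_neq0.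
apply: le_trans (hexp _ (le_lt_trans ze ed)) _.
rewrite expr2 modcM mulrA ler_pM2r ?modc_gt0 // mulrAC ler_pdivlMr //.
by rewrite ler_pM2l ?divr_gt0.
Qed.


End CauchyFormula.

(** * Derivatives along real curves and the mean value inequality *)

Section Curves.
Variable R : realType.
Local Notation C := (Cplx R).
Local Notation Re := complex.Re.
Local Notation Im := complex.Im.
Local Notation modc := (@ComplexField.Normc.normc R).

Record curve_derive (c : R -> C) (t : R) (D : C) : Prop := CurveDerive {
  curve_derive_Re : is_derive t 1 (fun s => Re (c s)) (Re D);
  curve_derive_Im : is_derive t 1 (fun s => Im (c s)) (Im D)
}.

Lemma is_derive_expansion (f : R -> R) (t d : R) :
  (forall eta, 0 < eta -> exists2 delta, 0 < delta &
    forall h, `|h| < delta -> `|f (t + h) - f t - h * d| <= eta * `|h|) ->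
  is_derive t 1 f d.
Proof.
move=> fd.
have q : h^-1 *: ((f \o shift t) (h *: 1) - f t) @[h --> 0^'] --> d.
  apply/cvgrPdist_lt => e e0.
  have [|delta d0 near_f] := fd (e / 2); first by rewrite divr_gt0.
  apply/nbhs_ballP; exists delta => // h; rewrite /ball /= sub0r normrN => hd h0.
  have hp : 0 < `|h| by rewrite normr_gt0.
  rewrite distrC -(ltr_pM2l hp) -normrM mulrBr.
  rewrite [_ *: 1]mulr1 [_ *: _]/(h^-1 * _) mulVKf // (addrC h t).
  apply: le_lt_trans (near_f _ hd) _; rewrite mulrC ltr_pM2l // ltr_pdivrMr //.
  by rewrite ltr_pMr // ltr1n.
apply: DeriveDef; first by apply/cvg_ex; exists d.
exact: (cvg_lim (@norm_hausdorff _ _) q).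
Qed.

Lemma curve_derive_expansion (c : R -> C) (t : R) (D : C) :
  (forall eta, 0 < eta -> exists2 delta, 0 < delta &
    forall h : R, `|h| < delta -> modc (c (t + h) - c t - h%:C * D) <= eta * `|h|) ->
  curve_derive c t D.
Proof.
move=> cd; split; apply: is_derive_expansion => eta /cd[delta d0 near_c];
  exists delta => // h /near_c; apply: le_trans.
  have -> : Re (c (t + h)) - Re (c t) - h * Re D = Re (c (t + h) - c t - h%:C * D).
    move: (c (t + h)) (c t) => [? ?] [? ?]; case: {+}D => [? ?] /=.
    by rewrite mul0r subr0.
  exact: Re_le_modc.
have -> : Im (c (t + h)) - Im (c t) - h * Im D = Im (c (t + h) - c t - h%:C * D).
  move: (c (t + h)) (c t) => [? ?] [? ?]; case: {+}D => [? ?] /=.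
  by rewrite mul0r addr0.
exact: Im_le_modc.
Qed.

Lemma curve_derive_line (V : normedModType C) (f : V -> C) (x v : V) (t : R) (D : C) :
  is_derive (x + t%:C *: v) v f D -> curve_derive (fun s => f (x + s%:C *: v)) t D.
Proof.
move=> /is_derive_modcP fD; apply: curve_derive_expansion => eta /fD[delta d0 near_f].
exists delta => // h hd; have := near_f h%:C; rewrite modc_real => /(_ hd).
by rewrite -[x + _ + _]addrA -scalerDl -rmorphD.
Qed.

Lemma is_derive_line (V : normedModType C) (f : V -> C) (x v : V) (s : C) (D : C) :
  is_derive (x + s *: v) v f D -> is_derive s 1 (fun z : C => f (x + z *: v)) D.
Proof.
move=> /is_derive_modcP fD; apply/is_derive_modcP => eta /fD[delta d0 near_f].
exists delta => // h /near_f.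
by rewrite -[x + _ + _]addrA -scalerDl [h *: (1 : C)]mulr1.
Qed.

Lemma is_derive_direction (f : C -> C) (z v D : C) :
  is_derive z 1 f D -> is_derive z v f (v * D).
Proof.
case=> /derivable1_diffP fz fD; apply: DeriveDef; first exact: diff_derivable.
by rewrite deriveE // -[v in LHS]mulr1 [v * 1]/(v *: (1 : C)) linearZ -deriveE // fD.
Qed.

Lemma real_mean_value (f : R -> R) (df : R -> R) (K : R) :
  (forall t : R, 0 <= t <= 1 -> is_derive t 1 f (df t)) ->
  (forall t : R, 0 <= t <= 1 -> `|df t| <= K) -> `|f 1 - f 0| <= K.
Proof.
move=> fd dK; have [|||t] := @MVT R f df 0 1.
- exact: ltr01.
- by move=> t; rewrite in_itv /= => /andP[/ltW t0 /ltW t1]; apply: fd; rewrite t0.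
- apply: derivable_within_continuous => t; rewrite in_itv /= => /fd ft.
  exact: (@ex_derive _ _ _ _ _ _ _ ft).
rewrite in_itv /= => /andP[/ltW t0 /ltW t1] ->; rewrite subr0 mulr1.
by apply: dK; rewrite t0.
Qed.

(** The real and imaginary parts are estimated separately, whence the factor 2. *)
Lemma complex_mean_value (h dh : C -> C) (a b : C) (K : R) :
  (forall t : R, 0 <= t <= 1 ->
     is_derive (a + t%:C * (b - a)) 1 h (dh (a + t%:C * (b - a)))) ->
  (forall t : R, 0 <= t <= 1 -> modc (dh (a + t%:C * (b - a))) <= K) ->
  modc (h b - h a) <= 2 * (K * modc (b - a)).
Proof.
move=> hd dK; pose c (t : R) := h (a + t%:C * (b - a)).
pose dc (t : R) := (b - a) * dh (a + t%:C * (b - a)).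
have cd t : 0 <= t <= 1 -> curve_derive c t (dc t).
  move=> t01; apply: (@curve_derive_line C h a (b - a) t).
  exact: is_derive_direction (hd _ t01).
have dcK t : 0 <= t <= 1 -> modc (dc t) <= K * modc (b - a).
  by move=> t01; rewrite modcM mulrC; rewrite ler_wpM2r ?modc_ge0 // dK.
have c0 : c 0 = h a by rewrite /c mul0r addr0.
have c1 : c 1 = h b by rewrite /c mul1r addrC subrK.
rewrite -c0 -c1; apply: le_trans (modc_le_ReIm _) _; rewrite mulr_natl mulr2n !raddfB.
apply: lerD.
  apply: (@real_mean_value (fun t => Re (c t)) (fun t => Re (dc t))) => t t01.
    by have [] := cd _ t01.
  exact: le_trans (Re_le_modc _) (dcK _ t01).
apply: (@real_mean_value (fun t => Im (c t)) (fun t => Im (dc t))) => t t01.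
  by have [] := cd _ t01.
exact: le_trans (Im_le_modc _) (dcK _ t01).
Qed.

End Curves.

(** * Cauchy's estimate along complex lines *)

Section CauchyEstimates.
Variable R : realType.
Local Notation C := (Cplx R).
Local Notation modc := (@ComplexField.Normc.normc R).

Record continuous_on_disc (phi : C -> C) (r : R) : Prop := ContinuousOnDisc {
  continuous_disc : forall z : C, modc z <= r -> {for z, continuous phi}
}.

(** The functional of Cauchy's formula: up to a constant, the derivative at 0. *)
Definition cauchy_functional (phi : C -> C) (r : R) : C :=
  squareint (fun z => phi z / z ^+ 2) r.

Lemma continuous_on_disc_frame phi r : 0 < r -> continuous_on_disc phi (2 * r) ->
  continuous_on_frame (fun z => phi z / z ^+ 2) (- r) r (- r) r.
Proof.
move=> r0 phic; apply: on_frame_impl (square_frame_modc r0) => z /[dup] zr /andP[_ z2].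
have z0 := square_frame_neq0 r0 zr.
exact: (continuousM (continuous_disc phic z2)
                    (derivable_continuous (inv_sqr_derivable z0))).
Qed.

Lemma continuous_on_discB phi psi r : continuous_on_disc phi r -> continuous_on_disc psi r ->
  continuous_on_disc (fun z => phi z - psi z) r.
Proof.
move=> pc qc; split=> z zr.
exact: (continuousB (continuous_disc pc zr) (continuous_disc qc zr)).
Qed.

Lemma continuous_on_discZ u phi r : continuous_on_disc phi r ->
  continuous_on_disc (fun z => u * phi z) r.
Proof. by move=> pc; split=> z zr; exact: continuous_scalel (continuous_disc pc zr). Qed.

Lemma cauchy_functionalB phi psi r : 0 < r ->
  continuous_on_disc phi (2 * r) -> continuous_on_disc psi (2 * r) ->
  cauchy_functional (fun z => phi z - psi z) r =
  cauchy_functional phi r - cauchy_functional psi r.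
Proof.
move=> r0 /(continuous_on_disc_frame r0) pc /(continuous_on_disc_frame r0) qc.
rewrite /cauchy_functional /squareint -(rectintB pc qc).
by apply: eq_rectint; split=> t _; rewrite !mulrBl.
Qed.

Lemma cauchy_functionalZ u phi r : 0 < r -> continuous_on_disc phi (2 * r) ->
  cauchy_functional (fun z => u * phi z) r = u * cauchy_functional phi r.
Proof.
move=> r0 /(continuous_on_disc_frame r0) pc.
rewrite /cauchy_functional /squareint -(rectintZ u pc).
by apply: eq_rectint; split=> t _; rewrite !mulrA.
Qed.

(** On the frame of the square the kernel is at most [r ^- 2], and the perimeter is [8 * r]. *)
Lemma cauchy_functional_bound phi r (M : R) : 0 < r ->
  continuous_on_disc phi (2 * r) -> (forall z : C, modc z <= 2 * r -> modc (phi z) <= M) ->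
  modc (cauchy_functional phi r) <= 16 * M / r.
Proof.
move=> r0 /(continuous_on_disc_frame r0) pc pM.
have rr : - r <= r by rewrite ge0_cp // ltW.
have -> : 16 * M / r = 4 * (M / r ^+ 2) * ((r - - r) + (r - - r)).
  by field; rewrite gt_eqF.
apply: (rectint_bound rr rr pc).
apply: on_frame_impl (square_frame_modc r0) => z /andP[rz zr].
have M0 : 0 <= M by exact: le_trans (modc_ge0 _) (pM _ zr).
have z0 : 0 < modc z by exact: lt_le_trans rz.
rewrite modcM modcV expr2 modcM -expr2.
apply: ler_pM; rewrite ?modc_ge0 ?invr_ge0 ?exprn_ge0 ?pM //; first exact: ltW.
by rewrite lef_pV2 ?posrE ?exprn_gt0 // ler_pXn2r ?nnegrE // ltW.
Qed.

Variable V : normedModType C.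
Implicit Types (f : V -> C) (x u w : V).

Lemma derivable_on_disc_line f x u r : 0 < r ->
  (forall s : C, modc s <= 2 * r -> derivable f (x + s *: u) u) ->
  continuous_on_disc (fun s : C => f (x + s *: u) - f x) (2 * r) /\
  cauchy_functional (fun s : C => f (x + s *: u) - f x) r = 'D_u f x * square_period R.
Proof.
move=> r0 fd.
have hd (s : C) : modc s <= 2 * r ->
    is_derive s 1 (fun t : C => f (x + t *: u)) ('D_u f (x + s *: u)).
  by move=> /fd/derivableP; exact: is_derive_line.
split.
  split=> s /hd[/derivable_continuous sc _].
  by apply: (continuousB sc); exact: cst_continuous.
pose h (t : C) := f (x + t *: u).
have x0 : x + (0 : C) *: u = x by rewrite scale0r addr0.
have h0 : h 0 = f x by rewrite /h x0.
have h'0 : is_derive (0 : C) 1 h ('D_u f x).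
  rewrite -[in 'D_u f x]x0; apply: hd.
  by rewrite ComplexField.Normc.normc0 mulr_ge0 // ltW.
rewrite -h0; apply: (@cauchy_derivative R h r ('D_u f x) r0 _ h'0).
split=> a b; rewrite -!ler_norml => ar br.
have [|hab _] := hd (a +i* b); last exact: hab.
by apply: le_trans (modc_le_ReIm _) _; rewrite mulr_natl mulr2n lerD.
Qed.

Definition cauchy_constant : R := 16 / modc (square_period R).

Lemma cauchy_constant_ge0 : 0 <= cauchy_constant.
Proof. by rewrite divr_ge0 // modc_ge0. Qed.

Lemma cauchy_estimate f x u r M : 0 < r ->
  (forall s : C, modc s <= 2 * r -> derivable f (x + s *: u) u) ->
  (forall s : C, modc s <= 2 * r -> modc (f (x + s *: u) - f x) <= M) ->
  modc ('D_u f x) <= cauchy_constant * M / r.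
Proof.
move=> r0 fd fM; have [fc fE] := derivable_on_disc_line r0 fd.
have P0 := modc_gt0 (square_period_neq0 R).
have := cauchy_functional_bound r0 fc fM; rewrite fE modcM -ler_pdivlMr //.
by rewrite /cauchy_constant mulrAC (mulrAC 16).
Qed.

End CauchyEstimates.

(** * Derivatives of holomorphic functions are holomorphic *)

Section SecondDerivative.
Variable R : realType.
Local Notation C := (Cplx R).
Local Notation modc := (@ComplexField.Normc.normc R).
Variable V : normedModType C.
Implicit Types (f : V -> C) (x u w : V).

Lemma is_derive_shift f x w u D :
  is_derive (x + w) u f D -> is_derive x u (fun y => f (y + w)) D.
Proof.
move=> /is_derive_modcP fD; apply/is_derive_modcP => eta /fD[delta d0 near_f].
by exists delta => // h /near_f; rewrite [x + w + _]addrAC.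
Qed.

(** The estimates lose radius at each step: [f] is bounded for parameters up to [8 * r],
    its derivatives up to [6 * r], and the increments of these up to [4 * r]. *)
Section Bidisc.
Variables (f : V -> C) (z w u : V) (r M : R).
Hypothesis r0 : 0 < r.
Let pt (s t : C) : V := z + s *: w + t *: u.
Hypothesis fd : forall s t : C, modc s <= 8 * r -> modc t <= 8 * r ->
  differentiable f (pt s t).
Hypothesis fM : forall s t : C, modc s <= 8 * r -> modc t <= 8 * r ->
  modc (f (pt s t)) <= M.

Let ptDs (s t h : C) : pt s t + h *: w = pt (s + h) t.
Proof. by rewrite /pt scalerDl addrAC addrA. Qed.

Let ptDt (s t h : C) : pt s t + h *: u = pt s (t + h).
Proof. by rewrite /pt scalerDl addrA. Qed.

Let modcDr (s h : C) (a b c : R) : modc s <= a -> modc h <= b -> a + b <= c ->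
  modc (s + h) <= c.
Proof. by move=> sa hb; apply: le_trans; apply: le_trans (modcD _ _) (lerD sa hb). Qed.

Let K1 := cauchy_constant R * (M + M) / r.
Let K2 := cauchy_constant R * (4 * K1) / r.

Let six_two : 6 * r + 2 * r <= 8 * r. Proof. by lra. Qed.
Let four_two : 4 * r + 2 * r <= 6 * r. Proof. by lra. Qed.
Let six_eight (s : C) : modc s <= 6 * r -> modc s <= 8 * r.
Proof. by move=> /le_trans; apply; rewrite ler_pM2r // ler_nat. Qed.
Let four_six (s : C) : modc s <= 4 * r -> modc s <= 6 * r.
Proof. by move=> /le_trans; apply; rewrite ler_pM2r // ler_nat. Qed.

Let bound_w (s t : C) : modc s <= 6 * r -> modc t <= 6 * r -> modc ('D_w f (pt s t)) <= K1.
Proof.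
move=> sr tr; apply: cauchy_estimate => // h hr; rewrite ptDs.
  by apply/diff_derivable/fd; [exact: modcDr sr hr six_two|exact: six_eight].
apply: le_trans (modcB _ _) _; apply: lerD; apply: fM; try exact: six_eight.
exact: modcDr sr hr six_two.
Qed.

Let bound_u (s t : C) : modc s <= 6 * r -> modc t <= 6 * r -> modc ('D_u f (pt s t)) <= K1.
Proof.
move=> sr tr; apply: cauchy_estimate => // h hr; rewrite ptDt.
  by apply/diff_derivable/fd; [exact: six_eight|exact: modcDr tr hr six_two].
apply: le_trans (modcB _ _) _; apply: lerD; apply: fM; try exact: six_eight.
exact: modcDr tr hr six_two.
Qed.

Let segment_modc (a b : C) (t c : R) : 0 <= t <= 1 -> modc a <= c -> modc b <= c ->
  modc (a + t%:C * (b - a)) <= c.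
Proof.
move=> /andP[t0 t1] ac bc.
have -> : a + t%:C * (b - a) = (1 - t)%:C * a + t%:C * b by rewrite rmorphB; ring.
apply: le_trans (modcD _ _) _; rewrite !modcM !modc_real !ger0_norm ?subr_ge0 //.
have -> : c = (1 - t) * c + t * c by ring.
by apply: lerD; apply: ler_wpM2l; rewrite ?subr_ge0.
Qed.

Let lip_w (s s' t : C) : modc s <= 6 * r -> modc s' <= 6 * r -> modc t <= 6 * r ->
  modc (f (pt s' t) - f (pt s t)) <= 2 * (K1 * modc (s' - s)).
Proof.
move=> sr sr' tr.
apply: (@complex_mean_value R (fun s => f (pt s t)) (fun s => 'D_w f (pt s t))) => a a01.
  have ar := segment_modc a01 sr sr'.
  have : derivable f (pt (s + a%:C * (s' - s)) t) w.
    by apply/diff_derivable/fd; exact: six_eight.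
  rewrite -[X in derivable f X]/(z + _ *: w + t *: u) addrAC => /derivableP/is_derive_line.
  rewrite /pt; under eq_fun do rewrite addrAC.
  by rewrite (addrAC z).
by apply: bound_w => //; exact: segment_modc.
Qed.

Let lip_u (s t t' : C) : modc s <= 6 * r -> modc t <= 6 * r -> modc t' <= 6 * r ->
  modc (f (pt s t') - f (pt s t)) <= 2 * (K1 * modc (t' - t)).
Proof.
move=> sr tr tr'.
apply: (@complex_mean_value R (fun t => f (pt s t)) (fun t => 'D_u f (pt s t))) => a a01.
  have ar := segment_modc a01 tr tr'.
  have : derivable f (pt s (t + a%:C * (t' - t))) u.
    by apply/diff_derivable/fd; exact: six_eight.
  by move=> /derivableP/is_derive_line.
by apply: bound_u => //; exact: segment_modc.
Qed.

Let lip (s t s' t' : C) : modc s <= 6 * r -> modc t <= 6 * r -> modc s' <= 6 * r ->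
  modc t' <= 6 * r ->
  modc (f (pt s' t') - f (pt s t)) <= 2 * (K1 * (modc (s' - s) + modc (t' - t))).
Proof.
move=> sr tr sr' tr'.
have -> : f (pt s' t') - f (pt s t) =
    (f (pt s' t') - f (pt s t')) + (f (pt s t') - f (pt s t)) by rewrite addrA subrK.
apply: le_trans (modcD _ _) _; rewrite !mulrDr; apply: lerD.
  exact: lip_w.
exact: lip_u.
Qed.

(** Cauchy's estimate for the increment of [f] under the translation that takes
    [pt s t] to [pt s' t']. *)
Let lip_derive_w (s t s' t' : C) : modc s <= 4 * r -> modc t <= 4 * r -> modc s' <= 4 * r ->
  modc t' <= 4 * r ->
  modc ('D_w f (pt s' t') - 'D_w f (pt s t)) <= K2 * (modc (s' - s) + modc (t' - t)).
Proof.
move=> sr tr sr' tr'; pose tau := pt s' t' - pt s t.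
pose g x := f (x + tau) - f x.
have tauE : pt s t + tau = pt s' t' by rewrite /tau [LHS]addrC subrK.
have tauDE (h : C) : pt (s + h) t + tau = pt (s' + h) t'.
  by rewrite -!ptDs addrAC tauE.
have t8 := six_eight (four_six tr); have t'8 := six_eight (four_six tr').
have gd a b : modc a <= 8 * r -> modc b <= 8 * r -> pt a t + tau = pt b t' ->
    is_derive (pt a t) w g ('D_w f (pt b t') - 'D_w f (pt a t)).
  move=> ar br abE; apply: is_deriveB.
    by apply: is_derive_shift; rewrite abE; apply/derivableP/diff_derivable/fd.
  by apply/derivableP/diff_derivable/fd.
have [_ <-] := gd s s' (six_eight (four_six sr)) (six_eight (four_six sr')) tauE.
set d := modc (s' - s) + modc (t' - t).
have -> : K2 * d = cauchy_constant R * (4 * (K1 * d)) / r by rewrite /K2; ring.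
apply: cauchy_estimate => // h hr; rewrite ptDs.
  have [||gh _] := gd (s + h) (s' + h) _ _ (tauDE h); last exact: gh.
    by apply: six_eight; exact: modcDr sr hr four_two.
  by apply: six_eight; exact: modcDr sr' hr four_two.
rewrite /g tauDE tauE; apply: le_trans (modcB _ _) _.
have -> : 4 * (K1 * d) = 2 * (K1 * d) + 2 * (K1 * d) by ring.
apply: lerD; last by apply: lip; exact: four_six.
have -> : d = modc (s' + h - (s + h)) + modc (t' - t) by rewrite opprD addrACA subrr addr0.
by apply: lip; do ?[exact: four_six]; [exact: modcDr sr hr four_two|exact: modcDr sr' hr four_two].
Qed.

Let K1_ge0 : 0 <= K1.
Proof.
have M0 : 0 <= M.
  apply: le_trans (modc_ge0 _) (fM (s := 0) (t := 0) _ _);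
  by rewrite ComplexField.Normc.normc0 mulr_ge0 // ltW.
apply: divr_ge0; last exact: ltW.
by apply: mulr_ge0; [exact: cauchy_constant_ge0|exact: addr_ge0].
Qed.

Let K2_ge0 : 0 <= K2.
Proof.
apply: divr_ge0; last exact: ltW.
by apply: mulr_ge0; [exact: cauchy_constant_ge0|exact: mulr_ge0].
Qed.

Let zero_small (c : R) : 0 <= c -> modc (0 : C) <= c * r.
Proof. by move=> c0; rewrite ComplexField.Normc.normc0 mulr_ge0 // ltW. Qed.

(** The mean value inequality for [f (pt a t) - a * 'D_w f (pt 0 t)] as a function of [a],
    whose derivative is Lipschitz and vanishes at 0. *)
Let quadratic_remainder (s t : C) : modc s <= 4 * r -> modc t <= 4 * r ->
  modc (f (pt s t) - f (pt 0 t) - s * 'D_w f (pt 0 t)) <= 2 * K2 * modc s ^+ 2.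
Proof.
move=> sr tr; have z4 := zero_small (ler0n R 4).
pose h (a : C) := f (pt a t) - a * 'D_w f (pt 0 t).
have -> : f (pt s t) - f (pt 0 t) - s * 'D_w f (pt 0 t) = h s - h 0.
  by rewrite /h mul0r subr0 addrAC.
have -> : 2 * K2 * modc s ^+ 2 = 2 * (K2 * modc s * modc (s - 0)).
  by rewrite subr0; ring.
apply: (@complex_mean_value R h (fun a => 'D_w f (pt a t) - 'D_w f (pt 0 t))) => a a01.
  have ar := segment_modc a01 z4 sr.
  apply: is_deriveB.
    have : derivable f (pt (0 + a%:C * (s - 0)) t) w.
      by apply/diff_derivable/fd; apply: six_eight; exact: four_six.
    rewrite -[X in derivable f X]/(z + _ *: w + t *: u) addrAC => /derivableP/is_derive_line.
    by rewrite /pt; under eq_fun do rewrite addrAC; rewrite (addrAC z).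
  apply/is_derive_modcP => eta eta0; exists 1 => // k _.
  rewrite [k *: (1 : C)]mulr1 mulrDl [_ + k * _]addrC addrK subrr.
  by rewrite ComplexField.Normc.normc0 mulr_ge0 ?modc_ge0 // ltW.
have ar := segment_modc a01 z4 sr.
apply: le_trans (lip_derive_w z4 tr ar tr) _.
rewrite subrr ComplexField.Normc.normc0 addr0 add0r !subr0.
apply: ler_wpM2l => //; rewrite modcM modc_real ger0_norm; last by case/andP: a01.
by rewrite ler_piMl ?modc_ge0 //; case/andP: a01.
Qed.

(** Cauchy's formula for ['D_u f], differentiated under the integral sign in the direction
    [w], has this numerator. *)
Let psi (t : C) := 'D_w f (pt 0 t) - 'D_w f (pt 0 0).

Let psi_continuous : continuous_on_disc psi (2 * r).
Proof.
have z4 := zero_small (ler0n R 4).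
split=> t tr; suff : psi @ t --> psi t by [].
apply: (proj2 (cvg_modcP (nbhs_filter t) psi (psi t))) => e e0; apply/near_modcP.
exists (Num.min r (e / (K2 + 1))).
  by rewrite lt_min r0 divr_gt0 // ltr_wpDl.
move=> t'; rewrite lt_min => /andP[/ltW t'r t'e].
have t4 : modc t <= 4 * r by apply: le_trans tr _; rewrite ler_pM2r // ler_nat.
have t'4 : modc t' <= 4 * r.
  have -> : t' = t + (t' - t) by rewrite [RHS]addrC subrK.
  apply: (modcDr tr t'r); rewrite -[X in _ + X]mul1r -mulrDl ler_pM2r //.
  by rewrite natr1 ler_nat.
have -> : psi t' - psi t = 'D_w f (pt 0 t') - 'D_w f (pt 0 t).
  by rewrite /psi opprB addrA subrK.
apply: le_lt_trans (lip_derive_w z4 t4 z4 t'4) _.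
rewrite subrr ComplexField.Normc.normc0 add0r.
apply: (@le_lt_trans _ _ ((K2 + 1) * modc (t' - t))).
  by rewrite ler_wpM2r ?modc_ge0 // lerDl.
by rewrite -ltr_pdivlMl ?ltr_wpDl // mulrC.
Qed.

Let regroup (a b c d x y s : C) :
  a - c - (b - d) - s * (x - y) = a - b - s * x - (c - d - s * y).
Proof. by ring. Qed.

(** The remainder in the expansion of ['D_u f (z + s *: w)] is, by Cauchy's formula in the
    direction [u], the Cauchy functional of first-order remainders of [f] in the direction
    [w]. These are quadratic in [s], uniformly over the disc of integration. *)
Lemma is_derive_derive_bidisc : is_derive z w (fun x => 'D_u f x)
  (cauchy_functional psi r / square_period R).
Proof.
have z4 := zero_small (ler0n R 4).
have pt00 : pt 0 0 = z by rewrite /pt !scale0r !addr0.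
have pts0 (s : C) : pt s 0 = z + s *: w by rewrite /pt scale0r addr0.
have P0 := square_period_neq0 R; have mP0 := modc_gt0 P0.
pose phi (s t : C) := f (pt s 0 + t *: u) - f (pt s 0).
have phiP (s : C) : modc s <= 4 * r -> continuous_on_disc (phi s) (2 * r) /\
    cauchy_functional (phi s) r = 'D_u f (pt s 0) * square_period R.
  move=> sr; apply: derivable_on_disc_line => // t tr.
  rewrite ptDt add0r; apply/diff_derivable/fd; first exact/six_eight/four_six.
  by apply: le_trans tr _; rewrite ler_pM2r // ler_nat.
pose K := 16 * (4 * K2) / r / modc (square_period R).
have K0 : 0 <= K.
  apply: divr_ge0; last exact: modc_ge0.
  apply: divr_ge0; last exact: ltW.
  by apply: mulr_ge0 => //; exact: mulr_ge0.
apply/is_derive_modcP => eta eta0.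
exists (Num.min r (eta / (K + 1))).
  by rewrite lt_min r0 divr_gt0 // ltr_wpDl.
move=> s; rewrite lt_min => /andP[sr seta].
have s4 : modc s <= 4 * r by apply: le_trans (ltW sr) _; rewrite ler_pMl // ler1n.
have [sc sE] := phiP s s4; have [oc oE] := phiP 0 z4.
have dc := continuous_on_discB sc oc.
have pc := continuous_on_discZ s psi_continuous.
have TE : cauchy_functional (fun t => (phi s t - phi 0 t) - s * psi t) r =
   ('D_u f (z + s *: w) - 'D_u f z - s * (cauchy_functional psi r / square_period R)) *
   square_period R.
  rewrite (cauchy_functionalB r0 dc pc) (cauchy_functionalB r0 sc oc) sE oE pt00 pts0.
  rewrite (cauchy_functionalZ s r0 psi_continuous) !mulrBl; congr (_ - _).
  by rewrite mulrA divfK.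
have bnd (t : C) : modc t <= 2 * r ->
    modc (phi s t - phi 0 t - s * psi t) <= 4 * K2 * modc s ^+ 2.
  move=> tr; have t4 : modc t <= 4 * r by apply: le_trans tr _; rewrite ler_pM2r // ler_nat.
  have -> : phi s t - phi 0 t - s * psi t =
      (f (pt s t) - f (pt 0 t) - s * 'D_w f (pt 0 t)) -
      (f (pt s 0) - f (pt 0 0) - s * 'D_w f (pt 0 0)).
    by rewrite /phi /psi !ptDt !add0r regroup.
  apply: le_trans (modcB _ _) _.
  have -> : 4 * K2 * modc s ^+ 2 = 2 * K2 * modc s ^+ 2 + 2 * K2 * modc s ^+ 2 by ring.
  by apply: lerD; exact: quadratic_remainder.
have := cauchy_functional_bound r0 (continuous_on_discB dc pc) bnd.
rewrite TE modcM -ler_pdivlMr // => /le_trans; apply.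
have -> : 16 * (4 * K2 * modc s ^+ 2) / r / modc (square_period R) = K * modc s * modc s.
  by rewrite /K; field; rewrite !gt_eqF.
rewrite ler_wpM2r ?modc_ge0 //.
apply: (@le_trans _ _ ((K + 1) * modc s)); first by rewrite ler_wpM2r ?modc_ge0 // lerDl.
by rewrite -ler_pdivlMl ?ltr_wpDl // mulrC ltW.
Qed.

End Bidisc.

(** Holomorphy is mere complex differentiability on an open set, without continuity of the
    differential, so this is where Goursat's theorem is needed. Near [z] the function is
    bounded, and a small enough bidisc in the directions [w] and [u] stays there. *)
Theorem derivable_derive f (U : set V) z u w : open U ->
  (forall x, U x -> differentiable f x) -> U z -> derivable (fun x => 'D_u f x) z w.
Proof.
move=> oU fd Uz.
have fz : f @ z --> f z by apply: differentiable_continuous; exact: fd.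
have near_fz := (proj1 (cvg_modcP (nbhs_filter z) f (f z))) fz 1 ltr01.
have near_z : \forall x \near z, differentiable f x /\ modc (f x) < modc (f z) + 1.
  have := open_nbhs_nbhs (conj oU Uz); apply: filterS2 near_fz => x fx /fd fdx.
  split=> //; rewrite -ltrBlDl; apply: le_lt_trans fx.
  by rewrite lerBlDl -{1}(subrK (f z) (f x)) addrC; exact: modcD.
have normE (x : V) : exists2 a : R, 0 <= a & `|x| = a%:C.
  exists (complex.Re `|x|); last by rewrite RRe_real // normr_real.
  by rewrite -ler0c RRe_real ?normr_real.
have [a a0 wa] := normE w; have [b b0 ub] := normE u.
have /nbhs_ballP[e /= e0 ball_e] := near_z.
have [d d0 de] : exists2 d : R, 0 < d & e = d%:C.
  exists (complex.Re e); last by rewrite RRe_real // gtr0_real.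
  by rewrite -ltcR RRe_real ?gtr0_real.
pose r := d / (8 * (a + b + 1)).
have ab0 : 0 < a + b + 1 by rewrite ltr_wpDl // addr_ge0.
have r0 : 0 < r by rewrite divr_gt0 // mulr_gt0.
have in_ball (s t : C) : modc s <= 8 * r -> modc t <= 8 * r ->
    differentiable f (z + s *: w + t *: u) /\
    modc (f (z + s *: w + t *: u)) < modc (f z) + 1.
  move=> sr tr; apply: ball_e; rewrite -ball_normE /ball_ /= -addrA opprD addrA subrr add0r.
  rewrite normrN; apply: le_lt_trans (ler_normD _ _) _.
  rewrite !normrZ wa ub de !normcE -!rmorphM -rmorphD ltcR.
  apply: (@le_lt_trans _ _ (8 * r * a + 8 * r * b)).
    by apply: lerD; apply: ler_wpM2r.
  rewrite -mulrDr /r; have -> : 8 * (d / (8 * (a + b + 1))) * (a + b) =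
      d * ((a + b) / (a + b + 1)) by field; rewrite gt_eqF.
  by rewrite gtr_pMr // ltr_pdivrMr // mul1r ltrDl.
have [||fdd _] := @is_derive_derive_bidisc f z w u r (modc (f z) + 1) r0.
- by move=> s t sr tr; have [] := in_ball s t sr tr.
- by move=> s t sr tr; have [_ /ltW] := in_ball s t sr tr.
- exact: fdd.
Qed.

End SecondDerivative.

(** * Wirtinger calculus *)

Section CurveCalculus.
Variable R : realType.
Local Notation C := (Cplx R).
Local Notation Re := complex.Re.
Local Notation Im := complex.Im.
Implicit Types (c d : R -> C) (D E : C) (t : R).

Lemma curve_derive_near c d t D : (\forall s \near t, c s = d s) ->
  curve_derive c t D -> curve_derive d t D.
Proof.
move=> cd [cr ci]; split.
  by apply: near_eq_is_derive cr; apply: filterS cd => s ->.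
by apply: near_eq_is_derive ci; apply: filterS cd => s ->.
Qed.

Lemma is_derive_ext (f g : R -> R) t (a b : R) :
  (forall s, f s = g s) -> a = b -> is_derive t 1 f a -> is_derive t 1 g b.
Proof. by move=> /funext -> ->. Qed.

Lemma curve_derive_cst (k : C) t : curve_derive (fun=> k) t 0.
Proof. by split; exact: is_derive_cst. Qed.

Lemma curve_deriveD c d t D E : curve_derive c t D -> curve_derive d t E ->
  curve_derive (fun s => c s + d s) t (D + E).
Proof.
move=> [cr ci] [dr di]; split.
  by apply: is_derive_ext (is_deriveD cr dr) => [s|]; rewrite raddfD.
by apply: is_derive_ext (is_deriveD ci di) => [s|]; rewrite raddfD.
Qed.

Lemma curve_deriveM c d t D E : curve_derive c t D -> curve_derive d t E ->
  curve_derive (fun s => c s * d s) t (D * d t + c t * E).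
Proof.
move=> [cr ci] [dr di]; split.
  apply: is_derive_ext (is_deriveB (is_deriveM cr dr) (is_deriveM ci di)) => [s|].
    rewrite -[LHS]/(Re (c s) * Re (d s) - Im (c s) * Im (d s)).
    by case: (c s) (d s) => [? ?] [? ?].
  case: (c t) (d t) {cr ci dr di} => [x y] [x' y']; case: D E => [a b] [a' b'] /=.
  by rewrite /GRing.scale /=; ring.
apply: is_derive_ext (is_deriveD (is_deriveM cr di) (is_deriveM ci dr)) => [s|].
  rewrite -[LHS]/(Re (c s) * Im (d s) + Im (c s) * Re (d s)).
  by case: (c s) (d s) => [? ?] [? ?].
case: (c t) (d t) {cr ci dr di} => [x y] [x' y']; case: D E => [a b] [a' b'] /=.
by rewrite /GRing.scale /=; ring.
Qed.

Lemma curve_derive_conj c t D : curve_derive c t D ->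
  curve_derive (fun s => (c s)^*) t (D^*).
Proof.
move=> [cr ci]; split.
  by apply: is_derive_ext cr => [s|]; [case: (c s)|case: D {ci}].
apply: is_derive_ext (is_deriveN ci) => [s|]; last by case: D {cr ci}.
by rewrite -[LHS]/(- Im (c s)); case: (c s).
Qed.

(** A real curve has a real derivative, so the chain rule of one real variable applies to
    its real part. *)
Lemma curve_derive_real (n f : R -> R) t (d : R) D :
  curve_derive (fun s => (n s)%:C) t D -> is_derive (n t) 1 f d ->
  curve_derive (fun s => (f (n s))%:C) t (d%:C * D).
Proof.
move=> [cr [_ ci]] fd; rewrite derive_cst in ci; case: D cr ci => x y /= cr ci; split.
  apply: is_derive_ext (is_derive1_comp fd cr) => [s //|].
  by rewrite /= -ci mulr0 subr0.
apply: is_derive_ext (is_derive_cst 0 t 1) => [s //|].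
by rewrite /= -ci mulr0 mul0r addr0.
Qed.

End CurveCalculus.

Section Wirtinger.
Variables (R : realType) (n : nat).
Local Notation C := (Cplx R).
Local Notation Cn := 'rV[Cplx R]_n.
Implicit Types (F G : Cn -> C) (z : Cn) (l : 'I_n).

(** Stronger than [dz l F z = a] and [dzbar l F z = b]: the real directional derivatives are
    asserted to exist, without which there is no product rule. *)
Record wirtinger l F z (a b : C) : Prop := Wirtinger {
  wirtinger_x : curve_derive (fun t : R => F (z + t%:C *: delta_mx 0 l)) 0 (a + b);
  wirtinger_y : curve_derive (fun t : R => F (z + t%:C *: ('i *: delta_mx 0 l))) 0
    ('i * (a - b))
}.

Lemma real_dir_deriveE F (u : Cn) z D :
  curve_derive (fun t : R => F (z + t%:C *: u)) 0 D -> real_dir_derive F u z = D.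
Proof.
move=> [cr ci]; rewrite /real_dir_derive !derive1E.
by rewrite (derive_val (is_derive := cr)) (derive_val (is_derive := ci)); case: D {cr ci}.
Qed.

Lemma conj_prod (a b : C) : (a * b)^* = a^* * b^*. Proof. exact: rmorphM. Qed.
Lemma conj_diff (a b : C) : (a - b)^* = a^* - b^*. Proof. exact: rmorphB. Qed.

Lemma mulii : 'i * 'i = -1 :> C. Proof. by rewrite -expr2 sqrCi. Qed.

Lemma dz_wirtinger l F z a b : wirtinger l F z a b -> dz l F z = a.
Proof.
move=> [/real_dir_deriveE fx /real_dir_deriveE fy]; rewrite /dz fx fy.
by rewrite mulrA mulii; field.
Qed.

Lemma dzbar_wirtinger l F z a b : wirtinger l F z a b -> dzbar l F z = b.
Proof.
move=> [/real_dir_deriveE fx /real_dir_deriveE fy]; rewrite /dzbar fx fy.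
by rewrite mulrA mulii; field.
Qed.

Lemma wirtinger_near l F G z a b : (\forall x \near z, F x = G x) ->
  wirtinger l F z a b -> wirtinger l G z a b.
Proof.
move=> FG.
have near_line (u : Cn) : \forall s \near (0 : R), F (z + s%:C *: u) = G (z + s%:C *: u).
  have : (fun s : R => z + s%:C *: u) @ (0 : R) --> z.
    have {2}-> : z = z + (0 : R)%:C *: u by rewrite scale0r addr0.
    apply: cvgD; first exact: cvg_cst.
    by apply: cvgZl; exact: continuous_real_complex.
  by move=> /(_ _ FG).
by move=> [fx fy]; split; [exact: curve_derive_near fx|exact: curve_derive_near fy].
Qed.

Lemma wirtinger_cst l (k : C) z : wirtinger l (fun=> k) z 0 0.
Proof.
by split; rewrite ?subr0 ?addr0 ?mulr0; exact: curve_derive_cst.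
Qed.

Lemma wirtingerD l F G z a b a' b' : wirtinger l F z a b -> wirtinger l G z a' b' ->
  wirtinger l (fun x => F x + G x) z (a + a') (b + b').
Proof.
move=> [fx fy] [gx gy]; split; first by rewrite addrACA; exact: curve_deriveD.
by rewrite opprD addrACA mulrDr; exact: curve_deriveD.
Qed.

Lemma wirtingerM l F G z a b a' b' : wirtinger l F z a b -> wirtinger l G z a' b' ->
  wirtinger l (fun x => F x * G x) z (a * G z + F z * a') (b * G z + F z * b').
Proof.
have at0 (u : Cn) : z + (0 : R)%:C *: u = z by rewrite scale0r addr0.
move=> [fx fy] [gx gy]; split.
  have := curve_deriveM fx gx; rewrite /= !at0.
  by rewrite mulrDl mulrDr addrACA.
have := curve_deriveM fy gy; rewrite /= !at0; congr curve_derive; ring.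
Qed.

Lemma wirtinger_conj l F z a b : wirtinger l F z a b ->
  wirtinger l (fun x => (F x)^*) z (b^*) (a^*).
Proof.
move=> [fx fy]; split.
  by have := curve_derive_conj fx; rewrite rmorphD addrC.
have := curve_derive_conj fy; congr curve_derive.
by rewrite conj_prod conj_diff conjCi mulNr -mulrN opprB.
Qed.

Lemma wirtinger_real l (N : Cn -> R) (f : R -> R) z (d : R) a b :
  wirtinger l (fun x => (N x)%:C) z a b -> is_derive (N z) 1 f d ->
  wirtinger l (fun x => (f (N x))%:C) z (d%:C * a) (d%:C * b).
Proof.
have at0 (u : Cn) : z + (0 : R)%:C *: u = z by rewrite scale0r addr0.
move=> [nx ny] fd; split.
  rewrite -mulrDr; apply: (curve_derive_real nx); by rewrite at0.
rewrite -mulrBr mulrCA; apply: (curve_derive_real ny); by rewrite at0.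
Qed.

Lemma wirtinger_sum (I : finType) l (F : I -> Cn -> C) z (a b : I -> C) :
  (forall i, wirtinger l (F i) z (a i) (b i)) ->
  wirtinger l (fun x => \sum_i F i x) z (\sum_i a i) (\sum_i b i).
Proof.
move=> Fab.
elim: (index_enum I) => [|i s IH].
  rewrite !big_nil; have -> : (fun x => \sum_(i <- [::]) F i x) = (fun=> 0).
    by apply/funext => x; rewrite big_nil.
  exact: wirtinger_cst.
rewrite !big_cons; have -> : (fun x => \sum_(j <- i :: s) F j x) =
    (fun x => F i x + \sum_(j <- s) F j x) by apply/funext => x; rewrite big_cons.
exact: wirtingerD.
Qed.

(** Complex differentiability gives the derivative along ['i *: delta_mx 0 l] as ['i] times
    that along [delta_mx 0 l]: the Cauchy-Riemann equation. *)
Lemma wirtinger_holomorphic l F z : derivable F z (delta_mx 0 l) ->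
  wirtinger l F z ('D_(delta_mx 0 l) F z) 0.
Proof.
move=> /derivableP Fd.
have at0 (u : Cn) : z + (0 : R)%:C *: u = z by rewrite scale0r addr0.
have Fi : is_derive z ('i *: delta_mx 0 l) F ('i * 'D_(delta_mx 0 l) F z).
  have /is_derive_direction : is_derive (0 : C) 1 (fun s => F (z + s *: delta_mx 0 l))
      ('D_(delta_mx 0 l) F z) by apply: is_derive_line; rewrite scale0r addr0.
  move=> /(_ 'i) /is_derive_modcP Fi; apply/is_derive_modcP => eta /Fi[e e0 near_F].
  exists e => // h /near_F; rewrite add0r scale0r addr0.
  by rewrite -[(h *: ('i : C)) *: _]scalerA.
split; rewrite ?addr0 ?subr0; apply: curve_derive_line; by rewrite at0.
Qed.

End Wirtinger.

(** * The trace inequality *)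

Section TraceRank.
Variable C : numClosedFieldType.
Local Open Scope sesquilinear_scope.

Lemma cauchy_schwarz_sum (I : finType) (a b : I -> C) :
  `|\sum_i a i * b i| ^+ 2 <= (\sum_i `|a i| ^+ 2) * (\sum_i `|b i| ^+ 2).
Proof.
pose u : 'rV[C]_#|I| := \row_k a (enum_val k).
pose v : 'rV[C]_#|I| := \row_k (b (enum_val k))^*.
have dotE (x y : 'rV[C]_#|I|) : dotmx x y = \sum_k x 0 k * (y 0 k)^*.
  by rewrite dotmxE mxE; apply: eq_bigr => k _; rewrite !mxE.
have reidx (F : I -> C) : \sum_i F i = \sum_(k < #|I|) F (enum_val k).
  rewrite (reindex (enum_val : 'I_#|I| -> I)) //.
  by apply: onW_bij; exact: enum_val_bij.
have : `|dotmx u v| ^+ 2 <= dotmx u u * dotmx v v := (CauchySchwarz _ u v).1.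
have -> : dotmx u v = \sum_i a i * b i.
  by rewrite dotE reidx; apply: eq_bigr => k _; rewrite !mxE conjCK.
have -> : dotmx u u = \sum_i `|a i| ^+ 2.
  by rewrite dotE reidx; apply: eq_bigr => k _; rewrite !mxE normCK.
have -> // : dotmx v v = \sum_i `|b i| ^+ 2.
by rewrite dotE reidx; apply: eq_bigr => k _; rewrite !mxE conjCK mulrC normCK.
Qed.

(** If the rows of [B] are an orthonormal basis of the row space of [M], then
    [M = M *m B^t* *m B], so [\tr M] is the inner product of [M] with the orthogonal
    projection [B^t* *m B], whose Hilbert-Schmidt norm is the square root of its rank. *)
Lemma trace_rank_bound p (M : 'M[C]_p) :
  `|\tr M| ^+ 2 <= (\rank M)%:R * \sum_i \sum_j `|M i j| ^+ 2.
Proof.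
pose B := schmidt (row_base M); pose P := B^t* *m B.
have /unitarymxP BB : B \is unitarymx by apply: schmidt_unitarymx; exact: rank_leq_col.
have MP : M *m P = M.
  have /submxP[X ->] : (M <= B)%MS.
    by rewrite -(eq_row_base M); exact: schmidt_sub.
  by rewrite /P -mulmxA (mulmxA B) BB mul1mx.
have PT : P^t* = P by rewrite /P trmx_mul map_mxM trmxCK.
have norm_P : \sum_i \sum_j `|P i j| ^+ 2 = (\rank M)%:R.
  rewrite -mxtrace1 -BB mxtrace_mulC -/P.
  have -> : P = P *m P^t* by rewrite PT /P -mulmxA (mulmxA B) BB mul1mx.
  rewrite {1}(_ : P *m P^t* = P); last by rewrite PT /P -mulmxA (mulmxA B) BB mul1mx.
  apply: eq_bigr => i _; rewrite mxE; apply: eq_bigr => j _.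
  by rewrite !mxE normCK.
rewrite -norm_P mulrC pair_big /= pair_big /=.
rewrite -{1}MP.
have -> : \tr (M *m P) = \sum_(ij : 'I_p * 'I_p) M ij.1 ij.2 * P ij.2 ij.1.
  rewrite -(pair_big xpredT xpredT (fun i j => M i j * P j i)) /=.
  by apply: eq_bigr => i _; rewrite mxE.
apply: le_trans (cauchy_schwarz_sum _ _) _.
rewrite -(pair_big xpredT xpredT (fun i j => `|P j i| ^+ 2)) /= exchange_big /=.
by rewrite (pair_big xpredT xpredT (fun i j => `|P i j| ^+ 2)).
Qed.

Let conjM (a b : C) : (a * b)^* = a^* * b^*. Proof. exact: rmorphM. Qed.
Let conjB (a b : C) : (a - b)^* = a^* - b^*. Proof. exact: rmorphB. Qed.
Let conj_sum (I : finType) (a : I -> C) : (\sum_i a i)^* = \sum_i (a i)^*.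
Proof. exact: rmorph_sum. Qed.
Let conj_inv (a : C) : (a^-1)^* = (a^*)^-1. Proof. exact: fmorphV. Qed.
Let conj_normsq (a : C) : a * a^* = `|a| ^+ 2. Proof. by rewrite normCK. Qed.

Variables (n p : nat).

(** The rank of [v] is at most its number of columns; its columns lie in a hyperplane. *)
Lemma rank_of_annihilated (g : 'rV[C]_p) (v : 'M[C]_(p, n)) (G : 'M[C]_(n, p)) :
  g != 0 -> g *m v = 0 -> (\rank (v *m G) <= minn n p.-1)%N.
Proof.
move=> g0 gv; rewrite leq_min; apply/andP; split.
  by apply: leq_trans (mxrankM_maxl _ _) (rank_leq_col _).
apply: leq_trans (mxrankM_maxl _ _) _.
have := mulmx0_rank_max gv; rewrite rank_rV g0 add1n => rv.
by rewrite -ltnS prednK //; exact: leq_trans rv.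
Qed.

Variables (g : 'rV[C]_p) (dg : 'M[C]_(n, p)) (v : 'M[C]_(p, n)).
Let N : C := \sum_j g 0 j * (g 0 j)^*.
Let dN l : C := \sum_j dg l j * (g 0 j)^*.

(** The complex Hessian of [log |g|^2] when [dg] is the Jacobian matrix of [g]. *)
Definition levi_form_log l m : C :=
  (\sum_j dg l j * (dg m j)^*) / N - dN l * (dN m)^* / N ^+ 2.

(** Let the rows of [G] be the components of the rows of [dg] orthogonal to [g]. Then
    [N * levi_form_log] is the Gram matrix of these rows, so the right-hand sum is the
    squared Hilbert-Schmidt norm of [v *m G] divided by [N]. As [g *m v = 0], replacing
    [dg] by [G] does not change the sum on the left, which becomes the trace of
    [v *m G], and the trace is bounded by the rank. *)
Lemma trace_levi_bound : N != 0 -> g *m v = 0 ->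
  `|\sum_l \sum_j v j l * dg l j| ^+ 2 / N <=
  (minn n p.-1)%:R * \sum_l \sum_m levi_form_log l m * \sum_j v j l * (v j m)^*.
Proof.
move=> N0 gv.
have Nge0 : 0 <= N by apply: sumr_ge0 => j _; exact: mul_conjC_ge0.
have Ngt0 : 0 < N by rewrite lt_def N0.
have g0 : g != 0.
  apply: contraNneq N0 => g0; rewrite /N g0 big1 // => j _.
  by rewrite mxE mul0r.
have NC : N^* = N by rewrite conj_Creal // ger0_real.
pose G : 'M[C]_(n, p) := \matrix_(l, j) (dg l j - dN l / N * g 0 j).
have GG l m : \sum_j G l j * (G m j)^* = N * levi_form_log l m.
  rewrite /levi_form_log.
  transitivity (\sum_j (dg l j * (dg m j)^* - (dN m)^* / N * (dg l j * (g 0 j)^*)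
     - dN l / N * (g 0 j * (dg m j)^*) + dN l / N * (dN m)^* / N * (g 0 j * (g 0 j)^*))).
    apply: eq_bigr => j _; rewrite !mxE conjB !conjM conj_inv NC; ring.
  rewrite big_split /= !sumrB -!mulr_sumr -/(dN l) -/N.
  have -> : \sum_j g 0 j * (dg m j)^* = (dN m)^*.
    rewrite conj_sum; apply: eq_bigr => j _.
    by rewrite conjM conjCK mulrC.
  by field.
have gv0 l : \sum_j g 0 j * v j l = 0.
  by have /matrixP/(_ 0 l) := gv; rewrite !mxE.
have trE : \tr (v *m G) = \sum_l \sum_j v j l * dg l j.
  transitivity (\sum_l \sum_j v j l * G l j).
    rewrite exchange_big /=; apply: eq_bigr => j _; rewrite mxE; exact: eq_bigr.
  apply: eq_bigr => l _.
  transitivity (\sum_j (v j l * dg l j - dN l / N * (g 0 j * v j l))).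
    by apply: eq_bigr => j _; rewrite mxE; ring.
  by rewrite sumrB -mulr_sumr gv0 mulr0 subr0.
have normE : \sum_j \sum_k `|(v *m G) j k| ^+ 2 =
    N * \sum_l \sum_m levi_form_log l m * \sum_j v j l * (v j m)^*.
  transitivity (\sum_j \sum_k \sum_l \sum_m (v j l * (v j m)^*) * (G l k * (G m k)^*)).
    apply: eq_bigr => j _; apply: eq_bigr => k _.
    rewrite -conj_normsq mxE conj_sum mulr_suml; apply: eq_bigr => l _.
    by rewrite mulr_sumr; apply: eq_bigr => m _; rewrite conjM; ring.
  rewrite mulr_sumr (eq_bigr (fun j => \sum_l \sum_m \sum_k
      (v j l * (v j m)^*) * (G l k * (G m k)^*))); last first.
    move=> j _; rewrite exchange_big /=; apply: eq_bigr => l _.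
    by rewrite exchange_big.
  rewrite exchange_big /=; apply: eq_bigr => l _.
  rewrite exchange_big /= mulr_sumr; apply: eq_bigr => m _.
  rewrite mulrA -GG mulr_sumr; apply: eq_bigr => j _.
  by rewrite -mulr_sumr mulrC.
rewrite -trE ler_pdivrMr //.
apply: le_trans (trace_rank_bound _) _.
rewrite -mulrA [X in _ <= _ * X]mulrC -normE; apply: ler_wpM2r.
  by apply: sumr_ge0 => i _; apply: sumr_ge0 => j _; rewrite exprn_ge0.
by rewrite ler_nat; exact: (rank_of_annihilated _ g0 gv).
Qed.

End TraceRank.

(** * Orthogonal projection onto a kernel *)

Section HermitianProjection.
Variable C : numClosedFieldType.
Local Open Scope sesquilinear_scope.

Lemma mulmx_adjoint_eq0 m n (A : 'M[C]_(m, n)) : A *m A^t* = 0 -> A = 0.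
Proof.
move=> AA; apply/matrixP => i j; rewrite mxE; apply/eqP.
have /matrixP/(_ i i) := AA; rewrite !mxE => /eqP.
rewrite psumr_eq0 => [/allP/(_ j)|k _]; last by rewrite !mxE mul_conjC_ge0.
by rewrite mem_index_enum !mxE mul_conjC_eq0 => /(_ isT).
Qed.

(** A row vector [y] in the kernel of the Gram matrix makes [y *m E] orthogonal to itself. *)
Lemma gram_unitmx r p (E : 'M[C]_(r, p)) : row_free E -> E *m E^t* \in unitmx.
Proof.
move=> Efree; rewrite -row_free_unit -kermx_eq0.
set K := kermx _; have KS : K *m (E *m E^t*) = 0 by exact: mulmx_ker.
have : K *m E = 0.
  by apply: mulmx_adjoint_eq0; rewrite trmx_mul map_mxM mulmxA -(mulmxA K) KS mul0mx.
by move=> /eqP; rewrite mulmx_free_eq0.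
Qed.

(** Both sides are the orthogonal projection onto the row space of [E]: multiplied on the
    left by [E] or by the adjoint of [g], their difference gives 0, and the rows of these
    two matrices span the whole space. *)
Lemma projection_kernel r p (E : 'M[C]_(r, p)) (g : 'cV[C]_p) :
  row_free E -> (E :=: kermx g)%MS -> (g^t* *m g) 0 0 != 0 ->
  E^t* *m invmx (E *m E^t*) *m E = 1%:M - ((g^t* *m g) 0 0)^-1 *: (g *m g^t*).
Proof.
move=> Efree Eker; set N := (g^t* *m g) 0 0 => N0.
have Eg : E *m g = 0 by apply/sub_kermxP; rewrite Eker.
have gE : g^t* *m E^t* = 0 by rewrite -map_mxM -trmx_mul Eg trmx0 map_mx0.
have gg : g^t* *m g = N%:M by rewrite [LHS]mx11_scalar.
have Sunit := gram_unitmx Efree.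
apply/eqP; rewrite -subr_eq0; set A := _ - _.
have EA : E *m A = 0.
  rewrite /A !mulmxBr mulmx1 -scalemxAr !mulmxA mulmxV // mul1mx Eg mul0mx scaler0.
  by rewrite subr0 subrr.
have gA : g^t* *m A = 0.
  rewrite /A !mulmxBr mulmx1 -scalemxAr !mulmxA gE !mul0mx gg mul_scalar_mx scalerA.
  by rewrite mulVf // scale1r subrr subrr.
rewrite -[A]mul1mx -[1%:M](subrK (N^-1 *: (g *m g^t*))) mulmxDl.
rewrite -scalemxAl -mulmxA gA mulmx0 scaler0 addr0.
suff /submxP[X ->] : (1%:M - N^-1 *: (g *m g^t*) <= E)%MS by rewrite -mulmxA EA mulmx0.
rewrite Eker; apply/sub_kermxP.
by rewrite mulmxBl mul1mx -scalemxAl -mulmxA gg mul_mx_scalar scalerA mulVf // scale1r subrr.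
Qed.

End HermitianProjection.

Section WirtingerHermitian.
Variables (R : realType) (n : nat).
Local Notation C := (Cplx R).
Local Notation Cn := 'rV[Cplx R]_n.

Lemma wirtinger_eq l (F : Cn -> C) z a b a' b' :
  wirtinger l F z a b -> a = a' -> b = b' -> wirtinger l F z a' b'.
Proof. by move=> ? <- <-. Qed.

Lemma wirtinger_hermitian (I : finType) l (f h : I -> Cn -> C) z :
  (forall i, derivable (f i) z (delta_mx 0 l)) ->
  (forall i, derivable (h i) z (delta_mx 0 l)) ->
  wirtinger l (fun x => \sum_i f i x * (h i x)^*) z
    (\sum_i 'D_(delta_mx 0 l) (f i) z * (h i z)^*)
    (\sum_i f i z * ('D_(delta_mx 0 l) (h i) z)^*).
Proof.
move=> fd hd; apply: wirtinger_sum => i.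
apply: wirtinger_eq (wirtingerM (wirtinger_holomorphic (fd i))
                       (wirtinger_conj (wirtinger_holomorphic (hd i)))) _ _.
  by rewrite conjC0 mulr0 addr0.
by rewrite mul0r add0r.
Qed.

End WirtingerHermitian.

(** * Derivatives of the weight *)

Section Curvature.
Variables (R : realType) (n p : nat).
Local Notation C := (Cplx R).
Local Notation Cn := 'rV[Cplx R]_n.
Variables (g : 'I_p -> Cn -> C) (gamma : R).

Definition partial (F : Cn -> C) (l : 'I_n) (x : Cn) : C := 'D_(delta_mx 0 l) F x.

(** [normsqC] is [normsq] as a complex-valued sum of Hermitian products, the form in which
    the Wirtinger calculus applies to it. *)
Definition normsqC (x : Cn) : C := \sum_j g j x * (g j x)^*.
Definition dz_normsq l (x : Cn) : C := \sum_j partial (g j) l x * (g j x)^*.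
Definition dzbar_normsq l (x : Cn) : C := \sum_j g j x * (partial (g j) l x)^*.
Definition weight (x : Cn) : C := (normsq g x `^ (- gamma))%:C.

Lemma normsqCE x : normsqC x = (normsq g x)%:C.
Proof.
rewrite /normsq rmorph_sum; apply: eq_bigr => j _.
by rewrite -normCK -add_Re2_Im2.
Qed.

Lemma normsq_gt0 x : (exists j, g j x != 0) -> 0 < normsq g x.
Proof.
move=> [j gj]; rewrite -ltcR -normsqCE /normsqC (bigD1 j) //=.
apply: ltr_wpDr; first by apply: sumr_ge0 => i _; exact: mul_conjC_ge0.
by rewrite mul_conjC_gt0.
Qed.

Variables (x : Cn).
Hypothesis gx : exists j, g j x != 0.
Hypothesis gd : forall j, differentiable (g j) x.

Lemma wirtinger_normsq l : wirtinger l (fun y => (normsq g y)%:C) x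
  (dz_normsq l x) (dzbar_normsq l x).
Proof.
rewrite (_ : (fun y => _) = normsqC); last by apply/funext => y; rewrite normsqCE.
by apply: wirtinger_hermitian => j; exact: diff_derivable.
Qed.

Lemma wirtinger_log_normsq l : wirtinger l (fun y => (ln (normsq g y))%:C) x
  (dz_normsq l x / normsqC x) (dzbar_normsq l x / normsqC x).
Proof.
apply: wirtinger_eq (wirtinger_real (wirtinger_normsq l) (is_derive1_ln (normsq_gt0 gx))) _ _.
  by rewrite normsqCE fmorphV mulrC.
by rewrite normsqCE fmorphV mulrC.
Qed.

Lemma wirtinger_inv_normsq l : wirtinger l (fun y => (normsqC y)^-1) x
  (- dz_normsq l x / normsqC x ^+ 2) (- dzbar_normsq l x / normsqC x ^+ 2).
Proof.
have N0 := normsq_gt0 gx.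
have invd : is_derive (normsq g x) 1 (fun y : R => y^-1) (- normsq g x ^- 2).
  have Nn0 : id (normsq g x) != 0 by rewrite gt_eqF.
  have := is_deriveV Nn0 (is_derive_id (normsq g x) (1 : R)).
  by rewrite [_ *: 1]mulr1.
rewrite (_ : (fun y => _) = (fun y => ((normsq g y)^-1)%:C)); last first.
  by apply/funext => y; rewrite normsqCE fmorphV.
apply: wirtinger_eq (wirtinger_real (wirtinger_normsq l) invd) _ _.
  by rewrite normsqCE rmorphN fmorphV rmorphXn mulrC mulrN mulNr.
by rewrite normsqCE rmorphN fmorphV rmorphXn mulrC mulrN mulNr.
Qed.

Lemma wirtinger_weight l : wirtinger l weight x
  (- gamma%:C * weight x * (dz_normsq l x / normsqC x))
  (- gamma%:C * weight x * (dzbar_normsq l x / normsqC x)).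
Proof.
have N0 := normsq_gt0 gx.
have valE : (- gamma * normsq g x `^ (- gamma - 1))%:C =
    - gamma%:C * weight x / normsqC x.
  have -> : normsq g x `^ (- gamma - 1) = normsq g x `^ (- gamma) / normsq g x.
    rewrite powRB; first by rewrite powRr1 // ltW.
    by apply/implyP => _; rewrite gt_eqF.
  by rewrite rmorphM rmorphN rmorphM fmorphV normsqCE mulrA.
apply: wirtinger_eq (wirtinger_real (wirtinger_normsq l)
                       (is_derive1_powR (- gamma) N0)) _ _.
  by rewrite valE; ring.
by rewrite valE; ring.
Qed.

End Curvature.

(** * Curvature in a holomorphic frame *)

Section FrameCurvature.
Variables (R : realType) (n p : nat).
Local Notation C := (Cplx R).
Local Notation Cn := 'rV[Cplx R]_n.
Local Open Scope sesquilinear_scope.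
Variables (g : 'I_p -> Cn -> C) (gamma : R) (U : set Cn) (z : Cn).
Hypothesis oU : open U.
Hypothesis Uz : U z.
Hypothesis g_off : forall x, U x -> exists j, g j x != 0.
Hypothesis g_hol : forall j, holomorphic_on U (g j).

Let near_U : \forall x \near z, U x.
Proof. exact: open_nbhs_nbhs. Qed.

Let N := normsqC g z.

Lemma normsqC_unit : N != 0.
Proof.
rewrite /N normsqCE gt_eqF // ltcR; exact/normsq_gt0/g_off. Qed.

(** The antiholomorphic factors are conjugates of first derivatives of holomorphic functions,
    so that second derivatives of holomorphic functions enter. *)
Lemma wirtinger_hermitian_partial (I : finType) (f h : I -> Cn -> C) l m :
  (forall i, holomorphic_on U (f i)) -> (forall i, holomorphic_on U (h i)) ->
  wirtinger l (fun x => \sum_i f i x * (partial (h i) m x)^*) z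
    (\sum_i partial (f i) l z * (partial (h i) m z)^*)
    (\sum_i f i z * (partial (fun y => partial (h i) m y) l z)^*).
Proof.
move=> f_hol h_hol; apply: wirtinger_hermitian => i; first exact/diff_derivable/f_hol.
exact: (derivable_derive oU (h_hol i) Uz).
Qed.

Definition value_row (x : Cn) : 'rV[C]_p := \row_j g j x.
Definition jacobian (x : Cn) : 'M[C]_(n, p) := \matrix_(l, j) partial (g j) l x.

Lemma normsqC_row x : normsqC g x = \sum_j value_row x 0 j * (value_row x 0 j)^*.
Proof. by apply: eq_bigr => j _; rewrite mxE. Qed.

Lemma levi_form_logE l m : levi_form_log (value_row z) (jacobian z) l m =
  (\sum_j partial (g j) l z * (partial (g j) m z)^*) / N
  - dz_normsq g l z * dzbar_normsq g m z / N ^+ 2.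
Proof.
rewrite /levi_form_log -normsqC_row.
congr (_ / _ - _ * _ / _).
- by apply: eq_bigr => j _; rewrite !mxE.
- by apply: eq_bigr => j _; rewrite !mxE.
- rewrite rmorph_sum; apply: eq_bigr => j _; rewrite !mxE.
  by rewrite rmorphM /= conjCK mulrC.
Qed.

Definition log_dzbar m (x : Cn) : C := dzbar_normsq g m x / normsqC g x.

Lemma wirtinger_log_dzbar l m : exists b, wirtinger l (log_dzbar m) z
  (levi_form_log (value_row z) (jacobian z) l m) b.
Proof.
eexists; apply: wirtinger_eq (wirtingerM (wirtinger_hermitian_partial l m g_hol g_hol)
  (wirtinger_inv_normsq (g_off Uz) (fun j => g_hol j Uz) l)) _ erefl.
by rewrite levi_form_logE /N /dzbar_normsq; ring.
Qed.

Lemma levi_log_normsq l m : dz l (dzbar m (fun x => (ln (normsq g x))%:C)) z =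
  levi_form_log (value_row z) (jacobian z) l m.
Proof.
have [b wb] := wirtinger_log_dzbar l m.
apply: dz_wirtinger; apply: wirtinger_near wb.
apply: filterS near_U => x Ux; apply/esym/dzbar_wirtinger.
by apply: wirtinger_log_normsq; [exact: g_off|move=> j; exact: g_hol].
Qed.

Section Frame.
Variables (r : nat) (E : Cn -> 'M[C]_(r, p)).
Hypothesis E_hol : forall a j, holomorphic_on U (fun x => E x a j).

Definition frame_partial l (x : Cn) : 'M[C]_(r, p) :=
  \matrix_(a, j) partial (fun y => E y a j) l x.

Let k := twisted_metric g gamma.
Let S x := E x *m (E x)^t*.
Let T m x := E x *m (frame_partial m x)^t*.
Let P l x := frame_partial l x *m (E x)^t*.

Let mulmx_adjE (q : nat) (A B : 'M[C]_(q, p)) a b :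
  (A *m B^t*) a b = \sum_j A a j * (B b j)^*.
Proof. by rewrite mxE; apply: eq_bigr => j _; rewrite !mxE. Qed.

Let mul3E (q : nat) (A B D : 'M[C]_q) a b :
  (A *m B *m D) a b = \sum_c \sum_d A a d * B d c * D c b.
Proof. by rewrite mxE; apply: eq_bigr => c _; rewrite mxE mulr_suml. Qed.

Let cancel_scale (u A B I : C) : u != 0 ->
  u^-1 * I * (u * A) * (u * B) = u * (A * I * B).
Proof. by move=> u0; field. Qed.

Let expand_prod (q : nat) (A B D : 'M[C]_q) (c1 c2 : C) : B \in unitmx ->
  (A - c1 *: B) *m invmx B *m (D - c2 *: B) =
  A *m invmx B *m D - c2 *: A - c1 *: (D - c2 *: B).
Proof.
move=> Bunit; rewrite [in LHS]mulmxBl mulmxBl -[(c1 *: B) *m _]scalemxAl mulmxV //.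
rewrite -scalemxAl mul1mx; congr (_ - _).
by rewrite mulmxBr -scalemxAr -[_ *m B]mulmxA mulVmx // mulmx1.
Qed.

Let regroup_term (W c x s w1 w2 y1 y2 d : C) :
  W * (c * x * s - y1 * y2 / d) * w1 * w2 =
  W * (c * (x * (s * w1 * w2)) - y1 * w1 * (y2 * w2) / d).
Proof. by ring. Qed.

Let subZE (A B : 'M[C]_r) (c : C) a b : (A - c *: B) a b = A a b - c * B a b.
Proof. by rewrite !mxE. Qed.

Let entry_expand (Q X A D B : 'M[C]_r) (c0 c1 c2 : C) a b :
  (Q - c0 *: X - c2 *: A - c1 *: (D - c2 *: B)) a b =
  Q a b - c0 * X a b - c2 * A a b - c1 * (D a b - c2 * B a b).
Proof. by rewrite !mxE. Qed.

Let SE x a b : S x a b = \sum_j E x a j * (E x b j)^*.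
Proof. exact: mulmx_adjE. Qed.

Let TE m x a b : T m x a b = \sum_j E x a j * (partial (fun y => E y b j) m x)^*.
Proof. by rewrite mulmx_adjE; apply: eq_bigr => j _; rewrite mxE. Qed.

Let PE l x a b : P l x a b = \sum_j partial (fun y => E y a j) l x * (E x b j)^*.
Proof. by rewrite mulmx_adjE; apply: eq_bigr => j _; rewrite mxE. Qed.

Let QE l m x a b : (frame_partial l x *m (frame_partial m x)^t*) a b =
  \sum_j partial (fun y => E y a j) l x * (partial (fun y => E y b j) m x)^*.
Proof.
rewrite mulmx_adjE; apply: eq_bigr => j _.
by congr (_ * _); [exact: mxE|congr (_^*); exact: mxE].
Qed.

Lemma gram_twisted x : gram k E x = weight g gamma x *: S x.
Proof.
apply/matrixP => a b; rewrite !mxE /k /twisted_metric /flat_metric /weight.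
rewrite powRN fmorphV mulrC; congr (_ * _).
by apply: eq_bigr => j _; rewrite !mxE.
Qed.

Lemma wirtinger_gram l x a b : U x -> wirtinger l (fun y => gram k E y a b) x
  (weight g gamma x * (P l x - (gamma%:C * (dz_normsq g l x / normsqC g x)) *: S x) a b)
  (weight g gamma x * (T l x - (gamma%:C * log_dzbar l x) *: S x) a b).
Proof.
move=> Ux.
rewrite (_ : (fun y => _) = (fun y => weight g gamma y * \sum_j E y a j * (E y b j)^*));
  last by apply/funext => y; rewrite gram_twisted mxE SE.
have hol_row c j : derivable (fun y => E y c j) x (delta_mx 0 l).
  exact/diff_derivable/E_hol.
rewrite !subZE PE TE SE /log_dzbar.
apply: wirtinger_eq (wirtingerM
    (wirtinger_weight gamma (g_off Ux) (fun j => g_hol j Ux) l)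
    (wirtinger_hermitian (hol_row a) (hol_row b))) _ _; rewrite /partial; ring.
Qed.

Lemma dz_gram l x a b : U x -> dz l (fun y => gram k E y a b) x =
  weight g gamma x * (P l x - (gamma%:C * (dz_normsq g l x / normsqC g x)) *: S x) a b.
Proof. by move=> Ux; exact: dz_wirtinger (wirtinger_gram l a b Ux). Qed.

Lemma dzbar_gram l x a b : U x -> dzbar l (fun y => gram k E y a b) x =
  weight g gamma x * (T l x - (gamma%:C * log_dzbar l x) *: S x) a b.
Proof. by move=> Ux; exact: dzbar_wirtinger (wirtinger_gram l a b Ux). Qed.

(** The formula for the first derivative holds throughout [U], so it can be differentiated
    again; [c1] and [c2] are the logarithmic derivatives of the weight up to sign. *)
Lemma dz_dzbar_gram l m a b (c1 := gamma%:C * (dz_normsq g l z / N))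
    (c2 := gamma%:C * log_dzbar m z) :
  dz l (dzbar m (fun y => gram k E y a b)) z = weight g gamma z *
    ((frame_partial l z *m (frame_partial m z)^t*) a b
     - (gamma%:C * levi_form_log (value_row z) (jacobian z) l m) * S z a b
     - c2 * P l z a b - c1 * (T m z a b - c2 * S z a b)).
Proof.
have [bq wq] := wirtinger_log_dzbar l m.
have hol_row c j : derivable (fun y => E y c j) z (delta_mx 0 l).
  exact/diff_derivable/E_hol.
have wS := wirtinger_hermitian (hol_row a) (hol_row b).
have wT := wirtinger_hermitian_partial l m (E_hol a) (E_hol b).
have ww := wirtinger_weight gamma (g_off Uz) (fun j => g_hol j Uz) l.
have wc := wirtinger_cst l (- gamma%:C : C) z.
have wfull := wirtingerM ww (wirtingerD wT (wirtingerM (wirtingerM wc wq) wS)).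
have nearE : \forall x \near z, weight g gamma x *
    (\sum_j E x a j * (partial (fun y => E y b j) m x)^* +
     - gamma%:C * log_dzbar m x * \sum_j E x a j * (E x b j)^*) =
    dzbar m (fun y => gram k E y a b) x.
  apply: filterS near_U => x Ux; rewrite dzbar_gram // subZE TE SE.
  by rewrite !mulNr.
rewrite (dz_wirtinger (wirtinger_near nearE wfull)) PE TE SE QE.
rewrite /c1 /c2 /partial -/N; ring.
Qed.

Hypothesis E_free : row_free (E z).
Hypothesis E_ker : forall x, U x -> (E x :=: kernel_bundle g x)%MS.

Let gcol : 'cV[C]_p := \col_j g j z.

Let weight_gt0 : 0 < weight g gamma z.
Proof. by rewrite ltcR powR_gt0 //; exact/normsq_gt0/g_off. Qed.

Let gcol_norm : (gcol^t* *m gcol) 0 0 = N.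
Proof. by rewrite mxE; apply: eq_bigr => j _; rewrite !mxE mulrC. Qed.

(** The curvature of the weight contributes [gamma] times the Levi form of [log |g|^2]. The
    rest is minus the second fundamental form squared: the Gram matrix of the components
    of the derivatives of the frame orthogonal to the kernel, that is, along the
    conjugate of [g]. *)
Lemma curvature_gram a b l m : curvature (gram k E) z a b l m =
  weight g gamma z * (gamma%:C * levi_form_log (value_row z) (jacobian z) l m * S z a b
    - (frame_partial l z *m gcol) a 0 * ((frame_partial m z *m gcol) b 0)^* / N).
Proof.
have Sunit : S z \in unitmx by exact: gram_unitmx.
have W0 : weight g gamma z != 0 by rewrite gt_eqF.
pose c1 : C := gamma%:C * (dz_normsq g l z / N).
pose c2 : C := gamma%:C * log_dzbar m z.
pose w := weight g gamma z.
have prodE : \sum_c \sum_d invmx (gram k E z) d c * dz l (fun x => gram k E x a d) z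
                                  * dzbar m (fun x => gram k E x c b) z =
    w * (((P l z - c1 *: S z) *m invmx (S z) *m (T m z - c2 *: S z)) a b).
  rewrite gram_twisted invmxZ; last by rewrite unitmxZ ?unitfE.
  rewrite mul3E mulr_sumr; apply: eq_bigr => c _.
  rewrite mulr_sumr; apply: eq_bigr => d _.
  rewrite (dz_gram l a d Uz) (dzbar_gram m c b Uz) -/w -/N -/c1 -/c2.
  have -> : (w^-1 *: invmx (S z)) d c = w^-1 * invmx (S z) d c by rewrite mxE.
  exact: cancel_scale.
have matE : (P l z - c1 *: S z) *m invmx (S z) *m (T m z - c2 *: S z) =
    P l z *m invmx (S z) *m T m z - c2 *: P l z - c1 *: (T m z - c2 *: S z).
  exact: expand_prod.
have projE : P l z *m invmx (S z) *m T m z =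
    frame_partial l z *m (frame_partial m z)^t* -
    N^-1 *: (frame_partial l z *m gcol *m (frame_partial m z *m gcol)^t*).
  have N0 : (gcol^t* *m gcol) 0 0 != 0 by rewrite gcol_norm normsqC_unit.
  have := projection_kernel E_free (E_ker Uz) N0; rewrite gcol_norm => proj.
  transitivity (frame_partial l z *m ((E z)^t* *m invmx (S z) *m E z) *m (frame_partial m z)^t*).
    by rewrite /P /T !mulmxA.
  rewrite proj mulmxBr mulmx1 mulmxBl -scalemxAr -scalemxAl; congr (_ - _ *: _).
  by rewrite trmx_mul map_mxM !mulmxA.
rewrite /curvature prodE matE projE dz_dzbar_gram -/w -/c1 -/c2.
rewrite entry_expand.
have -> : (frame_partial l z *m gcol *m (frame_partial m z *m gcol)^t*) a b =
    (frame_partial l z *m gcol) a 0 * ((frame_partial m z *m gcol) b 0)^*.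
  by rewrite mxE big_ord1 [_^t* _ _]mxE [_^T _ _]mxE.
rewrite -/c1.
move: ((frame_partial l z *m gcol) a 0) (((frame_partial m z *m gcol) b 0)^*)
  ((frame_partial l z *m (frame_partial m z)^t*) a b) (S z a b) (P l z a b) (T m z a b)
  => x y Q s pp t.
rewrite /c1 /c2; field; exact: normsqC_unit.
Qed.

Variable w : 'M[C]_(r, n).
Let v := (E z)^T *m w.

(** Obtained by differentiating [E *m g = 0]; it replaces the derivatives of the frame in the
    second fundamental form by those of [g]. *)
Lemma frame_partial_kernel l a :
  (frame_partial l z *m gcol) a 0 = - \sum_j E z a j * partial (g j) l z.
Proof.
have prodd : wirtinger l (fun x => \sum_j E x a j * g j x) z
    (\sum_j (partial (fun y => E y a j) l z * g j z + E z a j * partial (g j) l z))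
    (\sum_j (0 * g j z + E z a j * 0)).
  apply: wirtinger_sum => j; apply: wirtingerM; apply: wirtinger_holomorphic.
    exact/diff_derivable/E_hol.
  exact/diff_derivable/g_hol.
have zero_near : \forall x \near z, \sum_j E x a j * g j x = 0.
  apply: filterS near_U => x Ux.
  have /sub_kermxP/matrixP/(_ a 0) : (E x <= kernel_bundle g x)%MS by rewrite E_ker.
  rewrite !mxE => Eg0; apply: etrans Eg0.
  by apply: eq_bigr => j _; rewrite mxE.
have /eqP : \sum_j partial (fun y => E y a j) l z * g j z +
    \sum_j E z a j * partial (g j) l z = 0.
  rewrite -big_split /= -(dz_wirtinger (wirtinger_near zero_near prodd)).
  exact: dz_wirtinger (wirtinger_cst l 0 z).
rewrite addr_eq0 => /eqP <-.
apply: etrans (mxE _ _ _ _) _.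
by apply: eq_bigr => j _; congr (_ * _); exact: mxE.
Qed.

(** By the previous lemma the result depends on the frame only through [v]. *)
Lemma nakano_sum_gram : nakano_sum (gram k E) z w =
  weight g gamma z *
   (gamma%:C * (\sum_l \sum_m levi_form_log (value_row z) (jacobian z) l m *
                  \sum_j v j l * (v j m)^*)
    - `|\sum_l \sum_j v j l * jacobian z l j| ^+ 2 / N).
Proof.
pose y (l : 'I_n) a : C := (frame_partial l z *m gcol) a 0.
have vE l j : v j l = \sum_a E z a j * w a l.
  by rewrite mxE; apply: eq_bigr => a _; rewrite mxE.
have SvE l m : \sum_a \sum_b S z a b * w a l * (w b m)^* = \sum_j v j l * (v j m)^*.
  transitivity (\sum_a \sum_b \sum_j (E z a j * w a l) * (E z b j * w b m)^*).
    apply: eq_bigr => a _; apply: eq_bigr => b _; rewrite SE !mulr_suml.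
    by apply: eq_bigr => j _; rewrite conj_prod; ring.
  rewrite (eq_bigr (fun a => \sum_j \sum_b (E z a j * w a l) * (E z b j * w b m)^*)); last first.
    by move=> a _; rewrite exchange_big.
  rewrite exchange_big; apply: eq_bigr => j _ /=.
  rewrite !vE mulr_suml; apply: eq_bigr => a _.
  by rewrite -mulr_sumr; congr (_ * _); exact/esym/rmorph_sum.
have yE : \sum_l \sum_a y l a * w a l = - \sum_l \sum_j v j l * jacobian z l j.
  rewrite -sumrN; apply: eq_bigr => l _.
  transitivity (- \sum_j \sum_a (E z a j * w a l) * partial (g j) l z).
    rewrite exchange_big /= -sumrN; apply: eq_bigr => a _.
    rewrite /y frame_partial_kernel mulNr mulr_suml; congr (- _).
    by apply: eq_bigr => j _; ring.
  congr (- _); apply: eq_bigr => j _; rewrite vE mulr_suml; apply: eq_bigr => a _.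
  by congr (_ * _); exact/esym/mxE.
pose lam l m := levi_form_log (value_row z) (jacobian z) l m.
have termE a b l m : curvature (gram k E) z a b l m * w a l * (w b m)^* =
    weight g gamma z * (gamma%:C * (lam l m * (S z a b * w a l * (w b m)^*)) -
      (y l a * w a l) * (y m b * w b m)^* / N).
  by rewrite (curvature_gram a b l m) conj_prod; exact: regroup_term.
rewrite /nakano_sum.
transitivity (\sum_l \sum_m \sum_a \sum_b
    curvature (gram k E) z a b l m * w a l * (w b m)^*).
  rewrite (eq_bigr (fun a => \sum_l \sum_b \sum_m
    curvature (gram k E) z a b l m * w a l * (w b m)^*)); last first.
    by move=> a _; rewrite exchange_big.
  rewrite exchange_big; apply: eq_bigr => l _ /=.
  rewrite (eq_bigr (fun a => \sum_m \sum_b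
    curvature (gram k E) z a b l m * w a l * (w b m)^*)); last first.
    by move=> a _; rewrite exchange_big.
  by rewrite exchange_big.
have -> : `|\sum_l \sum_j v j l * jacobian z l j| ^+ 2 =
    \sum_l \sum_m (\sum_a y l a * w a l) * (\sum_b y m b * w b m)^*.
  rewrite -normrN -yE normCK rmorph_sum mulr_suml; apply: eq_bigr => l _.
  by rewrite mulr_sumr.
rewrite mulr_sumr mulr_suml -sumrB mulr_sumr; apply: eq_bigr => l _.
rewrite mulr_sumr mulr_suml -sumrB mulr_sumr; apply: eq_bigr => m _.
rewrite -SvE rmorph_sum !mulr_suml !mulr_sumr -sumrB mulr_sumr; apply: eq_bigr => a _.
rewrite !mulr_sumr !mulr_suml -sumrB mulr_sumr; apply: eq_bigr => b _.
exact: termE.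
Qed.

End Frame.
End FrameCurvature.

(** * Frames of the kernel and the domination *)

Section KernelFrame.
Variables (R : realType) (n q : nat).
Local Notation C := (Cplx R).
Local Notation Cn := 'rV[Cplx R]_n.
Variables (g : 'I_q.+1 -> Cn -> C) (j0 : 'I_q.+1).

(** On the open set where [g j0] does not vanish, the syzygies between [g j0] and the
    other [g j] form a holomorphic frame of the kernel. *)
Definition syzygy_frame (x : Cn) : 'M[C]_(q, q.+1) :=
  \matrix_(a, j) (g j0 x * (j == lift j0 a)%:R - g (lift j0 a) x * (j == j0)%:R).

Lemma sum_indicator (I : finType) (F : I -> C) i : \sum_j F j * (j == i)%:R = F i.
Proof.
rewrite (bigD1 i) //= eqxx mulr1 big1 ?addr0 // => j /negPf ->.
by rewrite mulr0.
Qed.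

Lemma syzygy_frame_free x : g j0 x != 0 -> row_free (syzygy_frame x).
Proof.
move=> gj0; apply/row_freeP.
exists ((g j0 x)^-1 *: \matrix_(j, a) (j == lift j0 a)%:R).
rewrite -scalemxAr; apply/matrixP => a b; rewrite !mxE.
have -> : \sum_j syzygy_frame x a j * (\matrix_(j, a) (j == lift j0 a)%:R : 'M[C]_(q.+1, q)) j b =
    syzygy_frame x a (lift j0 b).
  rewrite -[RHS](sum_indicator (fun j => syzygy_frame x a j) (lift j0 b)).
  by apply: eq_bigr => j _; congr (_ * _); exact: mxE.
rewrite mxE (inj_eq lift_inj) [lift j0 b == j0]eq_sym (negPf (neq_lift _ _)).
by rewrite mulr0 subr0 mulrA mulVf // mul1r eq_sym.
Qed.

Lemma syzygy_frame_kernel x : g j0 x != 0 -> (syzygy_frame x :=: kernel_bundle g x)%MS.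
Proof.
move=> gj0; set gc : 'cV[C]_q.+1 := \col_j g j x.
have Eg : syzygy_frame x *m gc = 0.
  apply/matrixP => a b; rewrite mxE [RHS]mxE.
  transitivity (\sum_j (g j0 x * (g j x * (j == lift j0 a)%:R) -
                        g (lift j0 a) x * (g j x * (j == j0)%:R))).
    by apply: eq_bigr => j _; rewrite !mxE; ring.
  by rewrite sumrB -!mulr_sumr !sum_indicator mulrC subrr.
have sub : (syzygy_frame x <= kernel_bundle g x)%MS by apply/sub_kermxP.
apply/eqmxP; rewrite -(mxrank_leqif_eq sub).2 (eqP (syzygy_frame_free gj0)).
rewrite mxrank_ker -mxrank_tr rank_rV -/gc.
have -> : gc^T != 0.
  by apply: contraNneq gj0 => /matrixP/(_ 0 j0); rewrite !mxE => ->.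
by rewrite subn1.
Qed.

Lemma syzygy_frame_holomorphic (U : set Cn) : (forall j, holomorphic_on U (g j)) ->
  forall a j, holomorphic_on U (fun x => syzygy_frame x a j).
Proof.
move=> g_hol a j x Ux.
rewrite (_ : (fun y => _) = (fun y => g j0 y * (j == lift j0 a)%:R -
  g (lift j0 a) y * (j == j0)%:R)); last by apply/funext => y; rewrite mxE.
apply: differentiableB; apply: differentiableM;
  by [exact: g_hol|exact: differentiable_cst].
Qed.

Lemma open_nonvanishing (Omega : set Cn) (f : Cn -> C) : open Omega ->
  holomorphic_on Omega f -> open (Omega `&` [set x | f x != 0]).
Proof.
move=> oO f_hol; rewrite openE => x [Ox fx].
have cf : f @ x --> f x by apply: differentiable_continuous; exact: f_hol.
have := (proj1 (cvg_modcP (nbhs_filter x) f (f x))) cf _ (modc_gt0 fx).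
apply: filterS2 (open_nbhs_nbhs (conj oO Ox)) => y Oy fy; split=> //=.
by apply: contraTneq fy => ->; rewrite sub0r modcN ltxx.
Qed.

End KernelFrame.

Section DominationProof.
Variables (R : realType) (n p : nat).
Local Notation C := (Cplx R).
Local Notation Cn := 'rV[Cplx R]_n.
Variables (Omega : set Cn) (g : 'I_p -> Cn -> C) (gamma : R).
Hypothesis oO : open Omega.
Hypothesis g_hol : forall j, holomorphic_on Omega (g j).
Variables (z : Cn) (v : 'M[C]_(p, n)).
Hypothesis z_off : off_zeros g Omega z.
Hypothesis v_ker : in_kernel_tensor_T g z v.

Lemma nakano_value_exists : exists c, nakano_value (off_zeros g Omega) (kernel_bundle g)
  (twisted_metric g gamma) z v c.
Proof.
have [Oz [j0 gj0]] := z_off.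
move: g g_hol v v_ker j0 gj0; case: p => [|q] h h_hol u u_ker j0 hj0; first by have := ltn_ord j0.
pose U := Omega `&` [set x | h j0 x != 0].
have oU : open U by exact: open_nonvanishing.
have U_hol j : holomorphic_on U (h j) by move=> x [Ox _]; exact: h_hol.
have uE : (u^T <= syzygy_frame h j0 z)%MS.
  rewrite syzygy_frame_kernel //; apply/sub_kermxP/matrixP => l i.
  rewrite [RHS]mxE mxE -[RHS](u_ker l); apply: eq_bigr => j _.
  by rewrite !mxE mulrC.
have /submxP[w uw] := uE.
exists (nakano_sum (gram (twisted_metric h gamma) (syzygy_frame h j0)) z w^T).
exists q, U, (syzygy_frame h j0), w^T; split=> //.
  split=> //.
  - by move=> x [Ox hx]; split=> //; exists j0.
  - exact: syzygy_frame_holomorphic.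
  - by move=> x [Ox hx]; split; [exact: syzygy_frame_free|exact: syzygy_frame_kernel].
by rewrite -trmx_mul -uw trmxK.
Qed.

Lemma id_tensor_leviE (U : set Cn) : open U -> U z ->
  (forall x, U x -> exists j, g j x != 0) -> (forall j, holomorphic_on U (g j)) ->
  id_tensor_levi (twisted_metric g gamma) (fun x => ln (normsq g x)) z v =
  weight g gamma z * \sum_l \sum_m levi_form_log (value_row g z) (jacobian g z) l m *
                  \sum_j v j l * (v j m)^*.
Proof.
move=> oU Uz g_off U_hol.
rewrite mulr_sumr; apply: eq_bigr => l _; rewrite mulr_sumr; apply: eq_bigr => m _.
rewrite (levi_log_normsq oU Uz g_off U_hol) [RHS]mulrCA; congr (_ * _).
rewrite /twisted_metric /weight powRN fmorphV mulrC; congr (_ * _).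
by apply: eq_bigr => j _; rewrite !mxE.
Qed.

Let scaled_domination (W L X : C) (m : nat) : X <= m%:R * L -> 0 <= W ->
  (gamma - m%:R)%:C * (W * L) <= W * (gamma%:C * L - X).
Proof.
move=> XL W0; rewrite mulrCA -subr_ge0 -mulrBr; apply: mulr_ge0 => //.
have -> : gamma%:C * L - X - (gamma - m%:R)%:C * L = m%:R * L - X.
  by rewrite rmorphB rmorph_nat; ring.
by rewrite subr_ge0.
Qed.

(** Both sides are [weight] times a combination of the Levi sum [L] and the second
    fundamental form, and the difference is the one estimated by [trace_levi_bound]. *)
Lemma nakano_value_bound c :
  nakano_value (off_zeros g Omega) (kernel_bundle g) (twisted_metric g gamma) z v c ->
  (gamma - (minn n p.-1)%:R)%:C *
    id_tensor_levi (twisted_metric g gamma) (fun x => ln (normsq g x)) z v <= c.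
Proof.
move=> [r [U [E [w [Uz [oU UX E_hol E_frame] vE ->]]]]].
have U_off x : U x -> exists j, g j x != 0 by move=> /UX[].
have U_hol j : holomorphic_on U (g j) by move=> x /UX[Ox _]; exact: g_hol.
have [E_free _] := E_frame z Uz.
have E_ker x : U x -> (E x :=: kernel_bundle g x)%MS by move=> /E_frame[].
have N0 := normsqC_unit Uz U_off.
rewrite (nakano_sum_gram gamma oU Uz U_off U_hol E_hol E_free E_ker) -vE.
have gv : value_row g z *m v = 0.
  apply/matrixP => i l; rewrite mxE [RHS]mxE -[RHS](v_ker l).
  by apply: eq_bigr => j _; rewrite mxE.
have N0' := N0; rewrite normsqC_row in N0'.
have := trace_levi_bound (jacobian g z) N0' gv; rewrite -normsqC_row.
rewrite (id_tensor_leviE oU Uz U_off U_hol).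
by move=> XL; apply: (scaled_domination XL); rewrite ler0c powR_ge0.
Qed.

End DominationProof.

Theorem proposition3p2 (R : realType) (n p : nat) (Omega : set 'rV[Cplx R]_n)
    (g : 'I_p -> 'rV[Cplx R]_n -> Cplx R) (gamma : R) :
  is_domain Omega ->
  (forall j, holomorphic_on Omega (g j)) ->
  0 < gamma ->
  (minn n p.-1)%:R <= gamma ->
  forall z, off_zeros g Omega z ->
  forall v : 'M[Cplx R]_(p, n), in_kernel_tensor_T g z v ->
  let curvature_value :=
    nakano_value (off_zeros g Omega) (kernel_bundle g) (twisted_metric g gamma) z v in
  (exists c, curvature_value c) /\
  (forall c, curvature_value c ->
     (gamma - (minn n p.-1)%:R)%:C *
       id_tensor_levi (twisted_metric g gamma) (fun x => ln (normsq g x)) z v <= c).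
Proof.
move=> [oO _ _] g_hol _ _ z z_off v v_ker; split; first exact: nakano_value_exists.
by move=> c; exact: nakano_value_bound.
Qed.
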